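(* Given a dynamic path network with $n$ vertices in which all edges have the same capacity, and an integer $k\ge1$, an optimal $k$-sink can be found in $O(n+k^2\log^2 n)$ time.
   Context: A dynamic path network $P$ consists of vertices $v_1,\dots,v_n$ arranged from left to right on a path; vertex $v_i$ has an integral weight $w_i>0$ (the number of evacuees at $v_i$), and each edge $e_i=(v_i,v_{i+1})$ has a non-negative length $l_i$ and a capacity $c_i>0$; here all $c_i$ are equal to a common value $c$. $\tau>0$ is the transit time per unit distance. $d(a,b)$ is the (prorated) distance between points $a,b$ of $P$; $c(a,b)$ is the minimum capacity of the edges between $a$ and $b$ (with $c(a,a)=+\infty$); $P[a,b]$ is the subpath from $a$ to $b$, $V[a,b]$ its vertex set; $W[v_i,v_j]=\sum_{l=i}^j w_l$. For a subpath $P[v_i,v_j]$ and sink $s\in P[v_i,v_j]$, the evacuation time is $\Theta(s,[v_i,v_j])=\max\{\max_{v_h\in V[v_i,s]}(d(v_h,s)\tau+W[v_i,v_h]/c(v_h,s)),\ \max_{v_h\in V[s,v_j]}(d(s,v_h)\tau+W[v_h,v_j]/c(s,v_h))\}$. The $k$-sink problem: choose $m\le k$, indices $0=j_0<j_1<\dots<j_m=n$ and sinks $s_q\in P[v_{j_{q-1}+1},v_{j_q}]$ minimizing $\max_q\Theta(s_q,[v_{j_{q-1}+1},v_{j_q}])$; an optimal $k$-sink is a choice attaining the minimum. *)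

(* Defs.v *)
From mathcomp Require Import all_boot all_order all_algebra.
From mathcomp Require Import reals constructive_ereal.

Set Implicit Arguments.
Unset Strict Implicit.
Unset Printing Implicit Defensive.

Import Order.TTheory GRing.Theory Num.Theory.
Local Open Scope ring_scope.

(** * Dynamic path networks *)

(* Vertices and edges are numbered from 0: with n = size weights, the vertices
   are v_0, ..., v_(n-1), and edge e joins v_e and v_(e+1). *)
Record network (R : realType) := Network {
  weights : seq nat;
  lengths : seq R;
  caps : seq R;
  tau : R  (* transit time per unit distance *)
}.

Definition nvert (R : realType) (P : network R) : nat := size (weights P).

Definition wf_network (R : realType) (P : network R) : Prop :=
  [/\ (0 < nvert P)%N,
      size (lengths P) = (nvert P).-1 /\ size (caps P) = (nvert P).-1,
      all (fun w => 0 < w)%N (weights P),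
      all (fun l => 0 <= l) (lengths P) /\ all (fun c => 0 < c) (caps P)
    & 0 < tau P].

Definition uniform_capacity (R : realType) (P : network R) : Prop :=
  constant (caps P).

(* (i, x) is the point at distance x to the right of v_i.  On a network this is
   a canonical form: x = 0 for the vertex v_i, and 0 < x < l_i for the points
   in the interior of edge i.  In particular the two endpoints of an edge of
   length 0 are different points. *)
Definition point (R : realType) : Type := (nat * R)%type.

Definition vertex (R : realType) (i : nat) : point R := (i, 0).

Definition on_path (R : realType) (P : network R) (a : point R) : bool :=
  [&& (a.1 < nvert P)%N, 0 <= a.2
    & (a.2 == 0) || (a.1.+1 < nvert P)%N && (a.2 < nth 0 (lengths P) a.1)].

(* a = b, or a is to the left of b *)
Definition left_of (R : realType) (a b : point R) : bool :=
  (a.1 < b.1)%N || (a.1 == b.1) && (a.2 <= b.2).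

Definition in_subpath (R : realType) (P : network R) (i j : nat) (s : point R)
    : bool :=
  [&& on_path P s, left_of (vertex R i) s & left_of s (vertex R j)].

Definition position (R : realType) (P : network R) (a : point R) : R :=
  \sum_(0 <= e < a.1) nth 0 (lengths P) e + a.2.

Definition dist (R : realType) (P : network R) (a b : point R) : R :=
  `|position P a - position P b|.

(* Minimum capacity of the edges between a and b, for a to the left of b; the
   edge containing b in its interior counts. *)
Definition capacity (R : realType) (P : network R) (a b : point R) : \bar R :=
  if a == b then +oo%E else
  \big[mine/+oo%E]_(0 <= e < size (caps P) |
     (a.1 <= e)%N && ((e < b.1)%N || (e == b.1) && (0 < b.2)))
     (nth 0 (caps P) e)%:E.

Definition total_weight (R : realType) (P : network R) (i j : nat) : nat :=
  \sum_(i <= h < j.+1) nth 0%N (weights P) h.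

(* In the library, r%:E / +oo = 0; the quotient is thus finite, as capacities
   are positive. *)
Definition crossing_time (R : realType) (W : nat) (c : \bar R) : R :=
  fine ((W%:R)%:E / c)%E.

(* All the terms are nonnegative, so that 0 is a neutral default for max. *)
Definition evac_time (R : realType) (P : network R) (s : point R) (i j : nat)
    : R :=
  Num.max
    (\big[Num.max/0]_(i <= h < j.+1 | left_of (vertex R h) s)
       (dist P (vertex R h) s * tau P
        + crossing_time (total_weight P i h) (capacity P (vertex R h) s)))
    (\big[Num.max/0]_(i <= h < j.+1 | left_of s (vertex R h))
       (dist P s (vertex R h) * tau P
        + crossing_time (total_weight P h j) (capacity P s (vertex R h)))).

(** * k-sinks *)

(* bounds = [:: j_0; ...; j_m] and sinks = [:: s_0; ...; s_(m-1)]; sink s_q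
   serves the vertices numbered j_q, ..., j_(q+1) - 1. *)
Record ksink (R : realType) := KSink {
  bounds : seq nat;
  sinks : seq (point R)
}.

Definition seg_first (R : realType) (S : ksink R) (q : nat) : nat :=
  nth 0%N (bounds S) q.
Definition seg_last (R : realType) (S : ksink R) (q : nat) : nat :=
  (nth 0%N (bounds S) q.+1).-1.
Definition sink (R : realType) (S : ksink R) (q : nat) : point R :=
  nth (vertex R 0) (sinks S) q.

Definition is_ksink (R : realType) (P : network R) (k : nat) (S : ksink R)
    : Prop :=
  let m := size (sinks S) in
  [/\ (m <= k)%N, size (bounds S) = m.+1,
      nth 0%N (bounds S) 0 = 0%N /\ nth 0%N (bounds S) m = nvert P,
      sorted ltn (bounds S)
    & forall q, (q < m)%N ->
        in_subpath P (seg_first S q) (seg_last S q) (sink S q)].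

Definition ksink_time (R : realType) (P : network R) (S : ksink R) : R :=
  \big[Num.max/0]_(0 <= q < size (sinks S))
     evac_time P (sink S q) (seg_first S q) (seg_last S q).

Definition optimal_ksink (R : realType) (P : network R) (k : nat) (S : ksink R)
    : Prop :=
  is_ksink P k S /\
  forall S', is_ksink P k S' -> ksink_time P S <= ksink_time P S'.

(** * Model of computation

   A unit-cost real RAM, programmed in a structured language.  There are
   integer variables and arrays, whose cells are machine words (naturals
   <= B; a computation that overflows is stuck), and real variables and arrays,
   on which only exact field operations and comparisons are available: there is
   no rounding, and no real constant other than images of words.  Variables and
   arrays are named by the numerals that occur in the program, so that a program
   has finitely many of them; arrays are addressed by words. *)

Inductive iexp : Type :=
| IConst of nat
| IVar of nat
| IGet of nat & iexp
| IAdd of iexp & iexp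
| ISub of iexp & iexp
| IMul of iexp & iexp
| IDiv of iexp & iexp.

Inductive rexp : Type :=
| ROfInt of iexp
| RVar of nat
| RGet of nat & iexp
| RAdd of rexp & rexp
| RSub of rexp & rexp
| RMul of rexp & rexp
| RDiv of rexp & rexp.

Inductive bexp : Type :=
| BIle of iexp & iexp
| BRle of rexp & rexp
| BNot of bexp
| BAnd of bexp & bexp.

Inductive com : Type :=
| Skip
| ISet of nat & iexp
| IPut of nat & iexp & iexp
| RSet of nat & rexp
| RPut of nat & iexp & rexp
| Seq of com & com
| If of bexp & com & com
| While of bexp & com.

Record state (R : realType) := State {
  ivar : nat -> nat;
  iarr : nat -> nat -> nat;
  rvar : nat -> R;
  rarr : nat -> nat -> R
}.

Definition upd (T : Type) (f : nat -> T) (i : nat) (x : T) : nat -> T :=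
  fun j => if j == i then x else f j.
Definition upd2 (T : Type) (f : nat -> nat -> T) (a i : nat) (x : T)
    : nat -> nat -> T :=
  upd f a (upd (f a) i x).

Definition set_ivar (R : realType) (s : state R) (x v : nat) : state R :=
  State (upd (ivar s) x v) (iarr s) (rvar s) (rarr s).
Definition set_iarr (R : realType) (s : state R) (a i v : nat) : state R :=
  State (ivar s) (upd2 (iarr s) a i v) (rvar s) (rarr s).
Definition set_rvar (R : realType) (s : state R) (x : nat) (v : R) : state R :=
  State (ivar s) (iarr s) (upd (rvar s) x v) (rarr s).
Definition set_rarr (R : realType) (s : state R) (a i : nat) (v : R)
    : state R :=
  State (ivar s) (iarr s) (rvar s) (upd2 (rarr s) a i v).

Definition word (B v : nat) : option nat := if (v <= B)%N then Some v else None.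

Definition lift2 (A1 A2 A3 : Type) (f : A1 -> A2 -> option A3)
    (u : option A1) (v : option A2) : option A3 :=
  obind (fun x => obind (f x) v) u.

(* Subtraction of words is truncated, and a quotient by 0 is 0. *)
Fixpoint ieval (R : realType) (B : nat) (s : state R) (e : iexp) : option nat :=
  match e with
  | IConst v => word B v
  | IVar x => Some (ivar s x)
  | IGet a e1 => omap (iarr s a) (ieval B s e1)
  | IAdd e1 e2 =>
      lift2 (fun u v => word B (u + v)%N) (ieval B s e1) (ieval B s e2)
  | ISub e1 e2 =>
      lift2 (fun u v => word B (u - v)%N) (ieval B s e1) (ieval B s e2)
  | IMul e1 e2 =>
      lift2 (fun u v => word B (u * v)%N) (ieval B s e1) (ieval B s e2)
  | IDiv e1 e2 =>
      lift2 (fun u v => word B (u %/ v)%N) (ieval B s e1) (ieval B s e2)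
  end.

Fixpoint reval (R : realType) (B : nat) (s : state R) (e : rexp) : option R :=
  match e with
  | ROfInt e1 => omap (fun v => v%:R) (ieval B s e1)
  | RVar x => Some (rvar s x)
  | RGet a e1 => omap (rarr s a) (ieval B s e1)
  | RAdd e1 e2 =>
      lift2 (fun u v => Some (u + v)) (reval B s e1) (reval B s e2)
  | RSub e1 e2 =>
      lift2 (fun u v => Some (u - v)) (reval B s e1) (reval B s e2)
  | RMul e1 e2 =>
      lift2 (fun u v => Some (u * v)) (reval B s e1) (reval B s e2)
  | RDiv e1 e2 =>
      lift2 (fun u v => Some (u / v)) (reval B s e1) (reval B s e2)
  end.

Fixpoint beval (R : realType) (B : nat) (s : state R) (b : bexp)
    : option bool :=
  match b with
  | BIle e1 e2 =>
      lift2 (fun u v => Some (u <= v)%N) (ieval B s e1) (ieval B s e2)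
  | BRle e1 e2 =>
      lift2 (fun u v => Some (u <= v)) (reval B s e1) (reval B s e2)
  | BNot b1 => omap negb (beval B s b1)
  | BAnd b1 b2 =>
      lift2 (fun u v => Some (u && v)) (beval B s b1) (beval B s b2)
  end.

(* Every node of an expression costs one unit each time it is evaluated. *)
Fixpoint icost (e : iexp) : nat :=
  match e with
  | IConst _ | IVar _ => 1
  | IGet _ e1 => (icost e1).+1
  | IAdd e1 e2 | ISub e1 e2 | IMul e1 e2 | IDiv e1 e2 =>
      (icost e1 + icost e2).+1
  end.

Fixpoint rcost (e : rexp) : nat :=
  match e with
  | RVar _ => 1
  | ROfInt e1 | RGet _ e1 => (icost e1).+1
  | RAdd e1 e2 | RSub e1 e2 | RMul e1 e2 | RDiv e1 e2 =>
      (rcost e1 + rcost e2).+1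
  end.

Fixpoint bcost (b : bexp) : nat :=
  match b with
  | BIle e1 e2 => (icost e1 + icost e2).+1
  | BRle e1 e2 => (rcost e1 + rcost e2).+1
  | BNot b1 => (bcost b1).+1
  | BAnd b1 b2 => (bcost b1 + bcost b2).+1
  end.

(* exec B p s t s': started in state s, program p halts in state s' after
   exactly t units of time. *)
Inductive exec (R : realType) (B : nat)
    : com -> state R -> nat -> state R -> Prop :=
| exec_skip s : exec B Skip s 1 s
| exec_iset s x e v :
    ieval B s e = Some v ->
    exec B (ISet x e) s (icost e).+1 (set_ivar s x v)
| exec_iput s a e1 e2 i v :
    ieval B s e1 = Some i -> ieval B s e2 = Some v ->
    exec B (IPut a e1 e2) s (icost e1 + icost e2).+1 (set_iarr s a i v)
| exec_rset s x e v :
    reval B s e = Some v ->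
    exec B (RSet x e) s (rcost e).+1 (set_rvar s x v)
| exec_rput s a e1 e2 i v :
    ieval B s e1 = Some i -> reval B s e2 = Some v ->
    exec B (RPut a e1 e2) s (icost e1 + rcost e2).+1 (set_rarr s a i v)
| exec_seq p1 p2 s s1 s2 t1 t2 :
    exec B p1 s t1 s1 -> exec B p2 s1 t2 s2 ->
    exec B (Seq p1 p2) s (t1 + t2) s2
| exec_if b p1 p2 s s' t c :
    beval B s b = Some c -> exec B (if c then p1 else p2) s t s' ->
    exec B (If b p1 p2) s (bcost b + t).+1 s'
| exec_while_false b p s :
    beval B s b = Some false ->
    exec B (While b p) s (bcost b).+1 s
| exec_while_true b p s s1 s2 t1 t2 :
    beval B s b = Some true ->
    exec B p s t1 s1 -> exec B (While b p) s1 t2 s2 ->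
    exec B (While b p) s (bcost b + t1 + t2).+1 s2.

(** * Input and output conventions *)

(* The words n and k are in integer variables 0 and 1, tau is in real variable
   0, and the weights, lengths and capacities are in real arrays 0, 1 and 2;
   the rest of the memory is 0.  The weights are stored as reals because they
   need not fit in a word. *)
Definition input_state (R : realType) (P : network R) (k : nat) : state R :=
  {| ivar := fun x => nth 0%N [:: nvert P; k] x;
     iarr := fun _ _ => 0%N;
     rvar := fun x => nth 0 [:: tau P] x;
     rarr := fun a i =>
       nth 0 (nth [::] [:: [seq w%:R | w <- weights P]; lengths P; caps P] a) i
  |}.

(* m is read from integer variable 2, j_0, ..., j_m from integer array 0, and
   the points s_0, ..., s_(m-1) from integer array 1 and real array 3. *)
Definition output_ksink (R : realType) (s : state R) : ksink R :=
  {| bounds := mkseq (iarr s 0) (ivar s 2).+1;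
     sinks := mkseq (fun q => (iarr s 1 q, rarr s 3 q)) (ivar s 2) |}.

(* Main.v *)
Require Import Defs.
From mathcomp Require Import all_boot all_order all_algebra.
From mathcomp Require Import reals constructive_ereal exp.
From mathcomp Require Import zify ring lra.

(* Put x_h = tau * d(v_0, v_h) and W_h = (w_0 + ... + w_(h-1)) / c.  A sink at
   scaled position y in the segment [v_i, v_j] has evacuation time at most lam
   iff y + (W_(h+1) - x_h) - W_i <= lam for the vertices v_h on its left and
   (x_h - W_h) + W_(j+1) - y <= lam for those on its right.  Hence, given lam, a
   segment starting at v_i is extended greedily: move the sink to the right as
   long as the first condition allows, then v_j as long as the second one does.
   Both searches are monotone in a running maximum, and so take O(log n) probes
   of a max tree built in O(n) time; testing lam takes O(k log n) time.
   The optimum is found by parametric search: run the greedy algorithm for an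
   unknown lam in [lo, hi), where lo is infeasible and hi feasible.  It only
   ever compares lam with known values v; each comparison is resolved by testing
   v, which narrows the interval.  The whole run is then the same for every lam
   in the final interval, so it fails for all of them, as it does for lo, and hi
   is optimal.  There are O(k log n) tests. *)

Set Implicit Arguments.
Unset Strict Implicit.
Unset Printing Implicit Defensive.

Import Order.TTheory GRing.Theory Num.Theory.
Local Open Scope ring_scope.

(** * Reasoning about programs *)

Section Machine.
Variables (R : realType) (B : nat).
Implicit Types (s : state R).

(** Evaluation without overflow checks; [isafe] collects those checks as a proposition, so that
    values are obtained by plain computation and overflow is left to linear arithmetic. *)
Fixpoint ival s (e : iexp) : nat :=
  match e with
  | IConst v => v
  | IVar x => ivar s x
  | IGet a e1 => iarr s a (ival s e1)
  | IAdd e1 e2 => (ival s e1 + ival s e2)%N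
  | ISub e1 e2 => (ival s e1 - ival s e2)%N
  | IMul e1 e2 => (ival s e1 * ival s e2)%N
  | IDiv e1 e2 => (ival s e1 %/ ival s e2)%N
  end.

Fixpoint isafe s (e : iexp) : Prop :=
  match e with
  | IConst v => (v <= B)%N
  | IVar _ => True
  | IGet _ e1 => isafe s e1
  | IAdd e1 e2 =>
      [/\ isafe s e1, isafe s e2 & (ival s e1 + ival s e2 <= B)%N]
  | ISub e1 e2 =>
      [/\ isafe s e1, isafe s e2 & (ival s e1 - ival s e2 <= B)%N]
  | IMul e1 e2 =>
      [/\ isafe s e1, isafe s e2 & (ival s e1 * ival s e2 <= B)%N]
  | IDiv e1 e2 =>
      [/\ isafe s e1, isafe s e2 & (ival s e1 %/ ival s e2 <= B)%N]
  end.

Fixpoint rval s (e : rexp) : R :=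
  match e with
  | ROfInt e1 => (ival s e1)%:R
  | RVar x => rvar s x
  | RGet a e1 => rarr s a (ival s e1)
  | RAdd e1 e2 => rval s e1 + rval s e2
  | RSub e1 e2 => rval s e1 - rval s e2
  | RMul e1 e2 => rval s e1 * rval s e2
  | RDiv e1 e2 => rval s e1 / rval s e2
  end.

Fixpoint rsafe s (e : rexp) : Prop :=
  match e with
  | RVar _ => True
  | ROfInt e1 | RGet _ e1 => isafe s e1
  | RAdd e1 e2 | RSub e1 e2 | RMul e1 e2 | RDiv e1 e2 => rsafe s e1 /\ rsafe s e2
  end.

Fixpoint bval s (b : bexp) : bool :=
  match b with
  | BIle e1 e2 => (ival s e1 <= ival s e2)%N
  | BRle e1 e2 => rval s e1 <= rval s e2
  | BNot b1 => ~~ bval s b1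
  | BAnd b1 b2 => bval s b1 && bval s b2
  end.

Fixpoint bsafe s (b : bexp) : Prop :=
  match b with
  | BIle e1 e2 => isafe s e1 /\ isafe s e2
  | BRle e1 e2 => rsafe s e1 /\ rsafe s e2
  | BNot b1 => bsafe s b1
  | BAnd b1 b2 => bsafe s b1 /\ bsafe s b2
  end.

Lemma ieval_safe s e : isafe s e -> ieval B s e = Some (ival s e).
Proof.
elim: e => [v|x|a e IH|e1 IH1 e2 IH2|e1 IH1 e2 IH2|e1 IH1 e2 IH2|e1 IH1 e2 IH2] //=.
- by rewrite /word => ->.
- by move/IH => ->.
- by case=> /IH1 -> /IH2 -> /=; rewrite /word => ->.
- by case=> /IH1 -> /IH2 -> /=; rewrite /word => ->.
- by case=> /IH1 -> /IH2 -> /=; rewrite /word => ->.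
- by case=> /IH1 -> /IH2 -> /=; rewrite /word => ->.
Qed.

Lemma reval_safe s e : rsafe s e -> reval B s e = Some (rval s e).
Proof.
elim: e => [e|x|a e|e1 IH1 e2 IH2|e1 IH1 e2 IH2|e1 IH1 e2 IH2|e1 IH1 e2 IH2] //=.
- by move/ieval_safe => ->.
- by move/ieval_safe => ->.
- by case=> /IH1 -> /IH2 ->.
- by case=> /IH1 -> /IH2 ->.
- by case=> /IH1 -> /IH2 ->.
- by case=> /IH1 -> /IH2 ->.
Qed.

Lemma beval_safe s b : bsafe s b -> beval B s b = Some (bval s b).
Proof.
elim: b => [e1 e2|e1 e2|b IH|b1 IH1 b2 IH2] /=.
- by case=> /ieval_safe -> /ieval_safe ->.
- by case=> /reval_safe -> /reval_safe ->.
- by move/IH => ->.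
- by case=> /IH1 -> /IH2 ->.
Qed.

(** Total correctness in weakest-precondition style. The postcondition also sees the elapsed time,
    so that cost and correctness are proved in one pass. *)
Definition run (p : com) s (Q : nat -> state R -> Prop) : Prop :=
  exists t s', exec B p s t s' /\ Q t s'.

Lemma run_conseq p s (Q Q' : nat -> state R -> Prop) :
  run p s Q -> (forall t s', Q t s' -> Q' t s') -> run p s Q'.
Proof. by case=> t [s' [E q]] H; exists t, s'; split=> //; apply: H. Qed.

Lemma run_skip s (Q : nat -> state R -> Prop) : Q 1%N s -> run Skip s Q.
Proof. by move=> q; exists 1%N, s; split=> //; constructor. Qed.

Lemma run_iset s x e (Q : nat -> state R -> Prop) :
  isafe s e -> Q (icost e).+1 (set_ivar s x (ival s e)) -> run (ISet x e) s Q.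
Proof.
by move=> /ieval_safe E q; exists (icost e).+1, (set_ivar s x (ival s e));
  split=> //; constructor.
Qed.

Lemma run_iput s a e1 e2 (Q : nat -> state R -> Prop) :
  isafe s e1 -> isafe s e2 ->
  Q (icost e1 + icost e2).+1 (set_iarr s a (ival s e1) (ival s e2)) ->
  run (IPut a e1 e2) s Q.
Proof.
move=> /ieval_safe E1 /ieval_safe E2 q; exists (icost e1 + icost e2).+1.
by exists (set_iarr s a (ival s e1) (ival s e2)); split=> //; constructor.
Qed.

Lemma run_rset s x e (Q : nat -> state R -> Prop) :
  rsafe s e -> Q (rcost e).+1 (set_rvar s x (rval s e)) -> run (RSet x e) s Q.
Proof.
by move=> /reval_safe E q; exists (rcost e).+1, (set_rvar s x (rval s e));
  split=> //; constructor.
Qed.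

Lemma run_rput s a e1 e2 (Q : nat -> state R -> Prop) :
  isafe s e1 -> rsafe s e2 ->
  Q (icost e1 + rcost e2).+1 (set_rarr s a (ival s e1) (rval s e2)) ->
  run (RPut a e1 e2) s Q.
Proof.
move=> /ieval_safe E1 /reval_safe E2 q; exists (icost e1 + rcost e2).+1.
by exists (set_rarr s a (ival s e1) (rval s e2)); split=> //; constructor.
Qed.

Lemma run_seq p1 p2 s (Q : nat -> state R -> Prop) :
  run p1 s (fun t1 s1 => run p2 s1 (fun t2 => Q (t1 + t2)%N)) ->
  run (Seq p1 p2) s Q.
Proof.
move=> [t1 [s1 [E1 [t2 [s2 [E2 q]]]]]]; exists (t1 + t2)%N, s2.
by split=> //; apply: exec_seq E2.
Qed.

Lemma run_if b p1 p2 s (Q : nat -> state R -> Prop) :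
  bsafe s b ->
  (bval s b -> run p1 s (fun t => Q (bcost b + t).+1)) ->
  (~~ bval s b -> run p2 s (fun t => Q (bcost b + t).+1)) ->
  run (If b p1 p2) s Q.
Proof.
move=> /beval_safe E H1 H2; suff: run (if bval s b then p1 else p2) s
    (fun t => Q (bcost b + t).+1).
  case=> t [s' [Ep q]]; exists (bcost b + t).+1, s'; split=> //.
  exact: exec_if E Ep.
by case: ifPn.
Qed.

(** The invariant carries a fuel that each iteration lowers by one; this gives termination and the
    time bound together. *)
Lemma run_while b p (I : nat -> state R -> Prop) T f s :
  (forall f s, I f s -> bsafe s b) ->
  (forall f s, I f s -> bval s b ->
     (0 < f)%N /\ run p s (fun t s' => (t <= T)%N /\ I f.-1 s')) ->
  I f s ->
  run (While b p) s
    (fun t s' => [/\ (t <= f * (T + bcost b).+1 + (bcost b).+1)%N,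
       ~~ bval s' b & exists f', I f' s']).
Proof.
move=> safe body; elim: f s => [|f IH] s If.
  have bF : ~~ bval s b.
    by apply/negP => bT; have [] := body _ _ If bT.
  exists (bcost b).+1, s; split; last by split=> //; exists 0%N.
  by apply: exec_while_false; rewrite (beval_safe (safe _ _ If)) (negbTE bF).
case bT: (bval s b); last first.
  exists (bcost b).+1, s; split.
    by apply: exec_while_false; rewrite (beval_safe (safe _ _ If)) bT.
  by split; [lia | rewrite bT | exists f.+1].
have [_ [t1 [s1 [E1 [Ht1 I1]]]]] := body _ _ If bT.
have [t2 [s2 [E2 [Ht2 bF I2]]]] := IH _ I1.
exists (bcost b + t1 + t2).+1, s2; split.
  by apply: exec_while_true E1 E2; rewrite (beval_safe (safe _ _ If)) bT.
by split=> //; lia.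
Qed.

End Machine.

(** * Evacuation times with uniform capacity *)

Lemma bigmax_seq_leP (R : realType) (I : eqType) (r : seq I) (Q : pred I)
    (F : I -> R) x m :
  reflect (x <= m /\ forall i, i \in r -> Q i -> F i <= m)
          (\big[Num.max/x]_(i <- r | Q i) F i <= m).
Proof.
elim: r => [|i r IH].
  by rewrite big_nil; apply: (iffP idP) => [xm|[]].
rewrite big_cons; case: ifP => Qi; last first.
  apply: (iffP IH) => -[xm H]; split=> // l.
    by rewrite inE => /orP[/eqP -> |/H//]; rewrite Qi.
  by move=> lr; apply: H; rewrite inE lr orbT.
rewrite ge_max; apply: (iffP andP) => [[Fi /IH[xm H]]|[xm H]].
  by split=> // l; rewrite inE => /orP[/eqP -> //|/H].
split; first by apply: H => //; rewrite inE eqxx.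
by apply/IH; split=> // l lr; apply: H; rewrite inE lr orbT.
Qed.

(** * Running maxima and farthest reachable indices *)

Section RunningMax.
Variable R : realType.
Implicit Types (A : nat -> R) (f : nat -> R -> R).

(* The default value [A i] is harmless when [i < p]. *)
Definition range_max A i p : R := \big[Num.max/A i]_(i <= h < p) A h.

Lemma range_maxP A i p m :
  reflect (A i <= m /\ forall h, (i <= h < p)%N -> A h <= m)
          (range_max A i p <= m).
Proof.
apply: (iffP (bigmax_seq_leP _ _ _ _ _)) => -[Ai H]; split=> //.
  by move=> h hp; apply: H; rewrite ?mem_index_iota.
by move=> h; rewrite mem_index_iota => hp _; apply: H.
Qed.

Lemma range_max_ge A i p h : (i <= h < p)%N -> A h <= range_max A i p.
Proof. by move=> ih; have /range_maxP[_] := lexx (range_max A i p); apply. Qed.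

Lemma range_max_ge0 A i p : A i <= range_max A i p.
Proof. by have /range_maxP[] := lexx (range_max A i p). Qed.

Lemma range_max_nil A i : range_max A i i = A i.
Proof. by rewrite /range_max big_geq. Qed.

Lemma range_max_ext A A' i p :
  A i = A' i -> (forall h, (i <= h < p)%N -> A h = A' h) ->
  range_max A i p = range_max A' i p.
Proof. by move=> Ei E; rewrite /range_max Ei; apply: eq_big_nat. Qed.

(** The bound [p < r] is strict because the default [A p] of the second maximum must be a genuine
    term of the whole range. *)
Lemma range_max_cat A i p r :
  (i <= p < r)%N ->
  range_max A i r = Num.max (range_max A i p) (range_max A p r).
Proof.
move=> /andP[ip pr]; apply/eqP; rewrite eq_le ge_max; apply/and3P; split.
- apply/range_maxP; rewrite le_max range_max_ge0; split=> // h /andP[ih hr].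
  case: (ltnP h p) => hp; first by rewrite le_max range_max_ge // ih.
  by rewrite le_max [X in _ || X]range_max_ge ?hp // orbT.
- apply/range_maxP; split=> [|h /andP[ih hp]]; first exact: range_max_ge0.
  by apply: range_max_ge; rewrite ih (ltn_trans hp).
- apply/range_maxP; split=> [|h /andP[ph hr]]; apply: range_max_ge.
    by rewrite ip.
  by rewrite hr (leq_trans ip).
Qed.

Lemma range_max_mono A i p r :
  (p <= r)%N -> range_max A i p <= range_max A i r.
Proof.
move=> pr; apply/range_maxP; split=> [|h /andP[ih hp]].
  exact: range_max_ge0.
by apply: range_max_ge; rewrite ih (leq_trans hp).
Qed.

Lemma range_maxS A i p :
  (i <= p)%N -> range_max A i p.+1 = Num.max (range_max A i p) (A p).
Proof.
move=> ip; rewrite (@range_max_cat A i p) ?ip ?ltnSn //.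
by rewrite [range_max A p _]/range_max big_ltn ?ltnSn // big_geq // maxxx.
Qed.

(** The start [i] is reached unconditionally: its range is empty, and [range_max] is then a mere
    default value. *)
Definition reaches lam A f i p : Prop :=
  p = i \/ f p (range_max A i p) <= lam.

Definition farthest n lam A f i p : Prop :=
  [/\ (i <= p < n)%N, reaches lam A f i p
    & (p.+1 < n)%N -> ~~ (f p.+1 (range_max A i p.+1) <= lam)].

(** Monotonicity turns the failure at [p.+1] into failure at all later indices. *)
Lemma farthest_max n lam A f i p r :
  (forall h h', (h <= h')%N ->
     f h (range_max A i h) <= f h' (range_max A i h')) ->
  farthest n lam A f i p -> (r < n)%N -> f r (range_max A i r) <= lam ->
  (r <= p)%N.
Proof.
move=> mono [_ _ far] rn fr; rewrite leqNgt; apply/negP => pr.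
by move/negP: (far (leq_ltn_trans pr rn)); apply; apply: le_trans (mono _ _ pr) fr.
Qed.

End RunningMax.

(** * One segment: evacuation conditions and the greedy choice *)

Section Path.
Variables (R : realType) (P : network R).
Hypotheses (wfP : wf_network P) (unif : uniform_capacity P).
Local Notation n := (nvert P).
Local Notation c := (nth 0 (caps P) 0).

Definition transit (h : nat) : R :=
  (\sum_(0 <= e < h) nth 0 (lengths P) e) * tau P.
Definition load (h : nat) : R :=
  (\sum_(0 <= l < h) nth 0%N (weights P) l)%N%:R / c.
Definition lkey (h : nat) : R := load h.+1 - transit h.
(** Index [h] stands for the vertex v_(h+1): with this shift, the vertices after v_q up to v_j form
    the range [q, j). *)
Definition rkey (h : nat) : R := transit h.+1 - load h.+1.

Lemma tau_gt0 : 0 < tau P. Proof. by case: wfP. Qed.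

Lemma length_ge0 e : 0 <= nth 0 (lengths P) e.
Proof.
case: wfP => _ _ _ [/allP H _] _; case: (ltnP e (size (lengths P))) => he.
  by apply: H; apply: mem_nth.
by rewrite nth_default.
Qed.

(** The inequality is weak because a single vertex has no edge: [c] is then the default 0 and all
    loads are 0. *)
Lemma cap_ge0 : 0 <= c.
Proof.
case: wfP => _ _ _ [_ /allP H] _; case: (ltnP 0 (size (caps P))) => he.
  by apply/ltW/H; apply: mem_nth.
by rewrite nth_default.
Qed.

Lemma cap_gt0 : (1 < n)%N -> 0 < c.
Proof.
case: wfP => _ [_ sc] _ [_ /allP H] _ n1.
by apply: H; apply: mem_nth; rewrite sc; lia.
Qed.

Lemma capE e : (e < size (caps P))%N -> nth 0 (caps P) e = c.
Proof.
move: unif; rewrite /uniform_capacity; case: (caps P) => [//|x l] /= /all_pred1P.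
by move=> E; case: e => [//|e] /=; rewrite ltnS E nth_nseq size_nseq => ->.
Qed.

Lemma transitS h : transit h.+1 = transit h + nth 0 (lengths P) h * tau P.
Proof. by rewrite /transit big_nat_recr //= mulrDl. Qed.

Lemma loadS h : load h.+1 = load h + (nth 0%N (weights P) h)%:R / c.
Proof. by rewrite /load big_nat_recr //= natrD mulrDl. Qed.

Lemma transit_mono i j : (i <= j)%N -> transit i <= transit j.
Proof.
move=> ij; rewrite -(subnKC ij); elim: (j - i)%N => [|d IH]; first by rewrite addn0.
rewrite addnS transitS; apply: le_trans IH _; rewrite lerDl.
by apply: mulr_ge0; [exact: length_ge0 | apply/ltW/tau_gt0].
Qed.

Lemma load_mono i j : (i <= j)%N -> load i <= load j.
Proof.
move=> ij; rewrite -(subnKC ij); elim: (j - i)%N => [|d IH]; first by rewrite addn0.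
rewrite addnS loadS; apply: le_trans IH _; rewrite lerDl.
by apply: divr_ge0; [exact: ler0n | exact: cap_ge0].
Qed.

Lemma total_weightE i h :
  (i <= h.+1)%N -> (total_weight P i h)%:R / c = load h.+1 - load i.
Proof.
move=> ih; rewrite /load /total_weight (@big_cat_nat _ _ _ i 0%N) //= natrD mulrDl.
by rewrite addrAC subrr add0r.
Qed.

Lemma positionE q y : position P (q, y) * tau P = transit q + y * tau P.
Proof. by rewrite /position /transit mulrDl. Qed.

(** The edge [e] shows that the minimum is over a nonempty set, all of whose terms are c. *)
Lemma capacityE (a b : point R) e :
  a != b -> (e < size (caps P))%N -> (a.1 <= e)%N ->
  (e < b.1)%N || (e == b.1) && (0 < b.2) -> capacity P a b = c%:E.
Proof.
move=> ab eP ae eb; rewrite /capacity (negbTE ab).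
have bigE (r : seq nat) (Q : pred nat) :
    (forall i, i \in r -> (i < size (caps P))%N) ->
    \big[mine/+oo%E]_(i <- r | Q i) (nth 0 (caps P) i)%:E =
    if has Q r then c%:E else +oo%E.
  elim: r => [|i r IH] H; first by rewrite big_nil.
  rewrite big_cons IH /= => [|l lr]; last by apply: H; rewrite inE lr orbT.
  case: (Q i) => //=; rewrite capE; last by apply: H; rewrite inE eqxx.
  by case: ifP => _; [rewrite minxx | rewrite minEle leey].
rewrite bigE => [|i]; last by rewrite mem_index_iota.
case: ifP => // /negP[]; apply/hasP; exists e; rewrite ?mem_index_iota //.
by rewrite ae eb.
Qed.

Lemma crossing_timeE (W : nat) : 0 < c -> crossing_time W c%:E = W%:R / c.
Proof.
by move=> c0; rewrite /crossing_time inver (gt_eqF c0).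
Qed.

Lemma crossing_time_oo (W : nat) : crossing_time W (+oo%E : \bar R) = 0.
Proof. by rewrite /crossing_time invey mule0. Qed.


Lemma in_subpathP i j q y :
  in_subpath P i j (q, y) -> [/\ (i <= q < n)%N, (q <= j)%N, 0 <= y
    & 0 < y -> [/\ (q < j)%N, (q.+1 < n)%N & y < nth 0 (lengths P) q]].
Proof.
rewrite /in_subpath /on_path /left_of /vertex /= => /and3P[/and3P[qn y0 yl] iq qj].
split=> //; rewrite ?qn ?andbT.
- by move: iq => /orP[/ltnW //|/andP[/eqP -> //]].
- by move: qj => /orP[/ltnW //|/andP[/eqP -> //]].
- move=> y_gt0; move: yl; rewrite gt_eqF //= => /andP[qn1 yl].
  split=> //; move: qj => /orP[//|/andP[_]].
  by rewrite leNgt y_gt0.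
Qed.

(** The last condition says that v_h is strictly left of the sink; at the sink itself the capacity
    is +oo and the crossing time 0. *)
Lemma crossing_before q y h :
  (q < n)%N -> 0 <= y -> (0 < y -> (q.+1 < n)%N) -> (h < q)%N || (h == q) && (0 < y) ->
  forall W, crossing_time W (capacity P (vertex R h) (q, y)) = W%:R / c.
Proof.
move=> qn y0 yq hq W; case: (wfP) => _ [_ sc] _ _ _.
have n1 : (1 < n)%N.
  by move: hq => /orP[hq|/andP[_ /yq hq]]; lia.
rewrite (capacityE (e := h)) /= ?crossing_timeE ?cap_gt0 //.
- apply: contraL hq => /eqP[-> <-]; by rewrite ltnn ltxx andbF.
- by rewrite sc; move: hq => /orP[|/andP[/eqP -> /yq]]; lia.
Qed.

Lemma crossing_after q y h :
  (h < n)%N -> (q < h)%N ->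
  forall W, crossing_time W (capacity P (q, y) (vertex R h)) = W%:R / c.
Proof.
move=> hn qh W; case: (wfP) => _ [_ sc] _ _ _.
rewrite (capacityE (e := q)) /= ?crossing_timeE ?cap_gt0 ?qh //; try lia.
apply/negP => /eqP[E _]; lia.
Qed.

(** Distances and total weights are differences of prefix sums, so each term splits into the
    position of the sink, the key of a vertex and a boundary load. A vertex at the sink contributes
    0, which [0 <= lam] absorbs; so only vertices strictly on either side remain. *)
Lemma evac_timeP i j q y lam :
  in_subpath P i j (q, y) -> (j < n)%N -> 0 <= lam ->
  reflect
    ((forall h, (i <= h)%N -> (h < q)%N || (h == q) && (0 < y) ->
        transit q + y * tau P + lkey h - load i <= lam) /\
     (forall h, (q <= h < j)%N ->
        rkey h + load j.+1 - (transit q + y * tau P) <= lam))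
    (evac_time P (q, y) i j <= lam).
Proof.
move=> sP jn lam0; have [/andP[iq qn] qj y0 yP] := in_subpathP sP.
have t0 := tau_gt0; have xE h : position P (vertex R h) * tau P = transit h.
  by rewrite positionE mul0r addr0.
have ptE : position P (q, y) * tau P = transit q + y * tau P by exact: positionE.
have pt_ge h : (h <= q)%N -> transit h <= transit q + y * tau P.
  move=> hq; apply: le_trans (transit_mono hq) _; rewrite lerDl.
  by apply: mulr_ge0; rewrite // ltW.
have pt_le h : (q < h)%N -> transit q + y * tau P <= transit h.
  move=> qh; apply: le_trans (transit_mono qh); rewrite transitS lerD2l.
  apply: ler_wpM2r; first exact: ltW.
  case: (ltrP 0 y) => [/yP[_ _ /ltW]|yle] //.
  by apply: le_trans yle _; exact: length_ge0.
have distE a b : dist P a b * tau P = `|position P a * tau P - position P b * tau P|.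
  by rewrite /dist -mulrBl normrM (gtr0_norm t0).
rewrite /evac_time ge_max; apply: (iffP andP).
  move=> [/bigmax_seq_leP[_ HL] /bigmax_seq_leP[_ HR]]; split.
    move=> h ih hq; have := HL h.
    rewrite mem_index_iota distE xE ptE (crossing_before qn) // => [|/yP[]//].
    have hq' : (h <= q)%N by move: hq => /orP[/ltnW //|/andP[/eqP -> //]].
    rewrite total_weightE ?(leq_trans ih) // ler0_norm ?subr_le0 ?pt_ge //.
    rewrite /left_of /lkey /=; have -> : (h < j.+1)%N by lia.
    have -> : (h < q)%N || (h == q) && (0 <= y).
      by move: hq => /orP[-> //|/andP[-> /ltW ->]]; rewrite orbT.
    by move=> /(_ isT isT); lra.
  move=> h /andP[qh hj]; have := HR h.+1.
  rewrite mem_index_iota distE xE ptE crossing_after //; try lia.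
  rewrite total_weightE //; last by lia.
  rewrite ler0_norm ?subr_le0 ?pt_le // /left_of /rkey /=.
  have -> : (q < h.+1)%N by lia.
  have -> : (i <= h.+1 < j.+1)%N by lia.
  by move=> /(_ isT isT); lra.
move=> [HL HR]; split; apply/bigmax_seq_leP; split=> // h;
    rewrite mem_index_iota => /andP[ih hj].
  rewrite /left_of /= => hq.
  case hq': ((h < q)%N || (h == q) && (0 < y)).
    have := HL h ih hq'; rewrite distE xE ptE (crossing_before qn) // => [|/yP[]//].
    rewrite total_weightE ?(leq_trans ih) // /lkey => H.
    rewrite ler0_norm ?subr_le0 ?pt_ge //; last by move: hq; lia.
    by apply: le_trans H; lra.
  have [-> y00] : h = q /\ y = 0.
    move/negbT: hq'; rewrite negb_or => /andP[/negbTE hq1]; move: hq; rewrite hq1 /=.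
    move=> /andP[/eqP -> _]; rewrite eqxx /= -leNgt => yle; split=> //.
    by apply/eqP; rewrite eq_le yle.
  rewrite y00 /dist subrr normr0 mul0r add0r /capacity /vertex eqxx.
  by rewrite crossing_time_oo.
rewrite /left_of /= => qh.
case: (ltngtP q h) qh => //= [qh _|<- yle].
  have qhj : (q <= h.-1 < j)%N by lia.
  have := HR _ qhj; rewrite /rkey prednK ?(leq_trans _ qh) // => H.
  rewrite distE xE ptE crossing_after //; last by lia.
  rewrite total_weightE; last by lia.
  by rewrite ler0_norm ?subr_le0 ?pt_le //; lra.
have -> : y = 0 by apply/eqP; rewrite eq_le yle.
rewrite /dist subrr normr0 mul0r add0r /capacity /vertex eqxx.
by rewrite crossing_time_oo.
Qed.

Definition left_time i p (a : R) : R := transit p + a - load i.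

(* The second value is the time at which the reaches of an interior sink of the
   edge [q, q.+1] on the left and on the right balance. *)
Definition right_time q (M : R) p (b : R) : R :=
  Num.min (b + load p.+1 - transit q) ((b + load p.+1 + M) / 2).

(** The range includes v_q, which is strictly left of any sink inside edge [q]. For such a sink at
    scaled position y, the left side takes time y + [left_peak i q]. *)
Definition left_peak i q : R := range_max lkey i q.+1 - load i.

Definition greedy_segment lam i q j : Prop :=
  farthest n lam lkey (left_time i) i q /\
  farthest n lam rkey (right_time q (left_peak i q)) q j.

Lemma left_time_mono i h h' :
  (h <= h')%N -> left_time i h (range_max lkey i h) <=
                 left_time i h' (range_max lkey i h').
Proof.
move=> hh'; rewrite /left_time lerD2r lerD //; first exact: transit_mono.
exact: range_max_mono.
Qed.

Lemma right_time_mono q M h h' :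
  (h <= h')%N -> right_time q M h (range_max rkey q h) <=
                 right_time q M h' (range_max rkey q h').
Proof.
move=> hh'; have H1 := range_max_mono rkey q hh'; have H2 : load h.+1 <= load h'.+1.
  exact: load_mono.
rewrite /right_time le_min !ge_min; apply/andP; split; apply/orP; [left|right]; lra.
Qed.

(** The greedy segment cannot be outrun. A later start only lowers the left times, so the given sink
    has index [q' <= q]. If it is at or left of v_q, moving it to v_q only helps the vertices after
    v_q, which bounds the first argument of the minimum in [right_time]. If it is inside edge [q],
    adding the left and right conditions eliminates its position and bounds the second. *)
Lemma greedy_segment_max lam i q j i' j' s :
  0 <= lam -> greedy_segment lam i q j -> (i' <= i <= j')%N -> (j' < n)%N ->
  in_subpath P i' j' s -> evac_time P s i' j' <= lam -> (j' <= j)%N.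
Proof.
case: s => q' y lam0 [farL farR] /andP[i'i ij'] j'n sP evac.
have [/andP[iq' q'n] q'j' y0 yP] := in_subpathP sP.
have [HL HR] := elimT (evac_timeP sP j'n lam0) evac.
have [/andP[iq qn] goodq _] := farL; have [/andP[qj jn] _ _] := farR.
have t0 := tau_gt0; have yt0 : 0 <= y * tau P by apply: mulr_ge0 => //; exact: ltW.
have Wi : load i' <= load i by exact: load_mono.
have q'q : (q' <= q)%N.
  case: (leqP q' i) => [q'i|iq'2]; first exact: leq_trans q'i iq.
  apply: farthest_max farL q'n _ => [h h'|]; first exact: left_time_mono.
  rewrite /left_time -lerBrDr -lerBrDl opprK; apply/range_maxP; split=> [|h /andP[ih hq]].
    by have := HL i i'i; rewrite iq'2 => /(_ isT); lra.
  by have := HL h (leq_trans i'i ih); rewrite hq => /(_ isT); lra.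
case: (leqP j' q) => [j'q|qj']; first exact: leq_trans j'q qj.
apply: farthest_max farR j'n _ => [h h'|]; first exact: right_time_mono.
rewrite /right_time ge_min.
case: (ltrP 0 y) => [y_gt0|yle].
  have [q'j'2 q'n1 yl] := yP y_gt0.
  have [q'q2|qq'] := ltnP q' q.
    apply/orP; left; have ptq : transit q' + y * tau P <= transit q.
      apply: le_trans (transit_mono q'q2); rewrite transitS lerD2l.
      by rewrite ler_wpM2r ?ltW.
    rewrite lerBlDr -lerBrDr; apply/range_maxP; split=> [|h /andP[qh hj]].
      by have := HR q; rewrite q'q qj' => /(_ isT); lra.
    by have := HR h; rewrite (leq_trans q'q qh) hj => /(_ isT); lra.
  have {qq' q'q} Eq : q' = q by apply/eqP; rewrite eqn_leq q'q.
  rewrite {q'}Eq in sP evac iq' q'n q'j' yP HL HR q'j'2 q'n1 yl *.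
  apply/orP; right; have HM : left_peak i q <= lam - (transit q + y * tau P).
    have HLq h : (i <= h < q.+1)%N -> lkey h <= lam - (transit q + y * tau P) + load i.
      move=> /andP[ih hq]; have hq' : (h < q)%N || (h == q) && (0 < y).
        by rewrite y_gt0; lia.
      by have := HL h (leq_trans i'i ih) hq'; lra.
    rewrite /left_peak lerBlDr; apply/range_maxP; split=> //.
    by apply: HLq; rewrite leqnn ltnS.
  have HN : range_max rkey q j' <= lam + (transit q + y * tau P) - load j'.+1.
    apply/range_maxP; split=> [|h /andP[qh hj]].
      by have := HR q; rewrite leqnn qj' => /(_ isT); lra.
    by have := HR h; rewrite qh hj => /(_ isT); lra.
  lra.
have {}yle : y = 0 by apply/eqP; rewrite eq_le yle.
rewrite yle mul0r addr0 in HR; have Xq := transit_mono q'q.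
apply/orP; left; rewrite lerBlDr -lerBrDr; apply/range_maxP; split=> [|h /andP[qh hj]].
  by have := HR q; rewrite q'q qj' => /(_ isT); lra.
by have := HR h; rewrite (leq_trans q'q qh) hj => /(_ isT); lra.
Qed.

(** The sink goes as far right as the left condition allows, at scaled position lam -
    [left_peak i q], provided that this is beyond v_q and that the segment contains the edge. *)
Definition greedy_offset lam i q j : R :=
  if (q < j)%N && (left_peak i q + transit q < lam)
  then (lam - left_peak i q - transit q) / tau P else 0.

Lemma greedy_segment_time lam i q j :
  0 <= lam -> greedy_segment lam i q j ->
  in_subpath P i j (q, greedy_offset lam i q j) /\
  evac_time P (q, greedy_offset lam i q j) i j <= lam.
Proof.
move=> lam0 [[/andP[iq qn] goodq farq] [/andP[qj jn] goodj _]].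
have t0 := tau_gt0; rewrite /greedy_offset; set M := left_peak i q in goodj *.
case: ifPn => [/andP[qj' Mlam]|cond].
  set y := (lam - M - transit q) / tau P.
  have ytE : y * tau P = lam - M - transit q by rewrite /y divfK // gt_eqF.
  have y0 : 0 < y by apply: divr_gt0 => //; lra.
  have q1n : (q.+1 < n)%N := leq_ltn_trans qj' jn.
  (* The sink stays before v_(q+1), since v_(q+1) violates the left condition. *)
  have yl : y < nth 0 (lengths P) q.
    rewrite -(ltr_pM2r t0) ytE; have := farq q1n; rewrite -ltNge /left_time transitS.
    by rewrite /M /left_peak; lra.
  have sP : in_subpath P i j (q, y).
    rewrite /in_subpath /on_path /left_of /vertex /= qn (ltW y0) q1n yl qj' /=.
    by rewrite gt_eqF //=; move: iq; rewrite leq_eqVlt orbC => /orP[->|->]; rewrite ?orbT.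
  split=> //; apply/evac_timeP => //; rewrite ytE; split=> [h ih hq|h /andP[qh hj]].
    have hq' : (i <= h < q.+1)%N by rewrite ih; move: hq; rewrite y0; lia.
    by have := range_max_ge lkey hq'; rewrite /M /left_peak; lra.
  case: goodj => [Ej|]; first by move: qj'; rewrite Ej ltnn.
  (* The first argument of the minimum bounds the right time from v_q, hence from any point further
     right; the second is exactly the right condition at scaled position lam - M. *)
  have := @range_max_ge _ rkey q j h; rewrite qh hj => /(_ isT) Hh.
  by rewrite /right_time ge_min => /orP[H|H]; lra.
have sP : in_subpath P i j (q, 0).
  rewrite /in_subpath /on_path /left_of /vertex /= qn lexx eqxx /=.
  by rewrite !andbT !(orbC (_ < _)%N) -!leq_eqVlt iq.
split=> //; apply/evac_timeP => //; rewrite mul0r addr0; split=> [h ih|h /andP[qh hj]].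
  rewrite ltxx andbF orbF => hq; case: goodq => [Eq|]; first by lia.
  have := @range_max_ge _ lkey i q h; rewrite ih hq /left_time => /(_ isT); lra.
have qj' : (q < j)%N := leq_ltn_trans qh hj.
(* Here lam - M is at most [transit P q], so that the second argument of the minimum being at most
   lam implies the same for the first. *)
move: cond; rewrite qj' /= -leNgt => cond; case: goodj => [Ej|].
  by move: qj'; rewrite Ej ltnn.
have := @range_max_ge _ rkey q j h; rewrite qh hj => /(_ isT) Hh.
by rewrite /right_time ge_min => /orP[H|H]; lra.
Qed.

End Path.

(** * Chains of greedy segments and feasibility *)

Section Sinks.
Variables (R : realType) (P : network R) (k : nat).
Hypotheses (wfP : wf_network P) (unif : uniform_capacity P).
Local Notation n := (nvert P).

(* A k-sink for the first [i] vertices. *)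
Definition prefix_ksink lam r i (S : ksink R) : Prop :=
  [/\ size (sinks S) = r /\ size (bounds S) = r.+1,
      nth 0%N (bounds S) 0 = 0%N /\ nth 0%N (bounds S) r = i,
      sorted ltn (bounds S)
    & forall q, (q < r)%N ->
        in_subpath P (seg_first S q) (seg_last S q) (sink S q) /\
        evac_time P (sink S q) (seg_first S q) (seg_last S q) <= lam].

Lemma prefix_ksink_rcons lam r i q j S :
  0 <= lam -> prefix_ksink lam r i S -> greedy_segment P lam i q j ->
  prefix_ksink lam r.+1 j.+1
    (KSink (rcons (bounds S) j.+1)
           (rcons (sinks S) (q, greedy_offset P lam i q j))).
Proof.
move=> lam0 [[szs szb] [b0 br] srt H] G; split=> /=.
- by rewrite !size_rcons szs szb.
- by rewrite !nth_rcons szb /= ltnn eqxx b0.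
- case: G => [[/andP[iq _] _ _] [/andP[qj _] _ _]].
  move: srt szb br; case: (bounds S) => [//|b l] /= srt [szl] /= br.
  rewrite rcons_path srt /= -[last b l]/(last 0%N (b :: l)) -nth_last /= szl br.
  exact: leq_trans iq qj.
- move=> p; rewrite ltnS leq_eqVlt => /orP[/eqP ->|pr].
    rewrite /seg_first /seg_last /sink /= !nth_rcons szs szb ltnn eqxx.
    rewrite ltnSn ltnn eqxx br; exact: greedy_segment_time.
  rewrite /seg_first /seg_last /sink /= !nth_rcons szs szb pr !ltnS pr.
  by rewrite (ltnW pr); exact: H.
Qed.

Lemma prefix_ksinkT lam r S :
  0 <= lam -> (r <= k)%N -> prefix_ksink lam r n S ->
  is_ksink P k S /\ ksink_time P S <= lam.
Proof.
move=> lam0 rk [[szs szb] [b0 br] srt H]; split.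
  by split; rewrite ?szs // => q /H[].
apply/bigmax_seq_leP; split=> // q; rewrite mem_index_iota szs => /andP[_ qr] _.
by case: (H q qr).
Qed.

Inductive greedy_chain lam : nat -> nat -> Prop :=
| greedy_chain0 : greedy_chain lam 0 0
| greedy_chainS r i q j :
    greedy_chain lam r i -> (i < n)%N -> greedy_segment P lam i q j ->
    greedy_chain lam r.+1 j.+1.

Definition feasible lam : Prop :=
  exists S, is_ksink P k S /\ ksink_time P S <= lam.

Lemma greedy_chain_prefix lam r i :
  0 <= lam -> greedy_chain lam r i -> exists S, prefix_ksink lam r i S.
Proof.
move=> lam0; elim=> [|{}r {}i q j _ [S HS] _ G].
  by exists (KSink [:: 0%N] [::]).
by eexists; exact: prefix_ksink_rcons lam0 HS G.
Qed.

(** By induction, greedy covers at least as many vertices as [S] with equally many segments: if the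
    next segment of [S] ends at or after v_i, it also contains v_i, and [greedy_segment_max]
    applies. The [if] counts everything as covered once the segments of [S] are exhausted. *)
Lemma greedy_chain_ge lam r i S :
  0 <= lam -> is_ksink P k S -> ksink_time P S <= lam -> greedy_chain lam r i ->
  ((if r <= size (sinks S) then nth 0%N (bounds S) r else n) <= i)%N.
Proof.
move=> lam0 [_ szb [b0 bm] srt H] /bigmax_seq_leP[_ HT].
set m := size (sinks S) in szb bm H HT *.
elim=> [|{}r {}i q j _ IH ilt G]; first by rewrite leq0n b0.
have rm : (r < m)%N.
  rewrite ltnNge; apply/negP => mr; move: IH; case: (leqP r m) => [rm|_].
    have -> : r = m by apply/eqP; rewrite eqn_leq rm.
    by rewrite bm leqNgt ilt.
  by rewrite leqNgt ilt.
move: IH; rewrite (ltnW rm) rm => bi.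
have blt x y : (x < y)%N -> (y <= m)%N -> (nth 0%N (bounds S) x < nth 0%N (bounds S) y)%N.
  move=> xy ym; apply: (sorted_ltn_nth ltn_trans) => //; rewrite inE szb ltnS //.
  exact: ltnW (leq_trans xy ym).
have bn : (nth 0%N (bounds S) r.+1 <= n)%N.
  by move: rm; rewrite leq_eqVlt -bm => /orP[/eqP -> //|rm]; apply/ltnW/blt.
have b_gt : (nth 0%N (bounds S) r < nth 0%N (bounds S) r.+1)%N by apply: blt.
have [ij|ji] := ltnP i (nth 0%N (bounds S) r.+1); last first.
  case: G => [[/andP[iq _] _ _] [/andP[qj _] _ _]]; lia.
have HTr : evac_time P (sink S r) (seg_first S r) (seg_last S r) <= lam.
  by apply: HT => //; rewrite mem_index_iota.
suff : (seg_last S r <= j)%N by rewrite /seg_last; lia.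
by apply: (greedy_segment_max wfP unif lam0 G _ _ (H r rm) HTr);
   rewrite /seg_first /seg_last; lia.
Qed.

Lemma greedy_chain_le lam r i : greedy_chain lam r i -> (i <= n)%N.
Proof. by case=> // {}r {}i q j _ _ [_ [/andP[]]]. Qed.

(** The certificate of infeasibility: by [greedy_chain_ge], the last boundary n of a k-sink within
    [lam] would be at most [i]. *)
Lemma greedy_chain_feasible lam r i :
  0 <= lam -> greedy_chain lam r i -> (r <= k)%N -> (i < n)%N -> r = k \/ (n <= i)%N ->
  ~ feasible lam.
Proof.
move=> lam0 ch rk ilt [Er|]; last by rewrite leqNgt ilt.
move=> [S [HS HT]]; have := greedy_chain_ge lam0 HS HT ch.
case: HS => [mk szb [_ bm] _ _]; case: ifP => [rm|_]; last by rewrite leqNgt ilt.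
have -> : r = size (sinks S) by apply/eqP; rewrite eqn_leq rm Er mk.
by rewrite bm leqNgt ilt.
Qed.

Lemma feasible_mono lam lam' : lam <= lam' -> feasible lam -> feasible lam'.
Proof. by move=> le [S [HS /le_trans HT]]; exists S; split=> //; apply: HT. Qed.

Lemma ksink_time_ge0 S : 0 <= ksink_time P S.
Proof. by have /bigmax_seq_leP[] := lexx (ksink_time P S). Qed.

Lemma ex_feasible : (0 < k)%N -> exists lam, feasible lam.
Proof.
move=> k_gt0; case: (wfP) => n0 _ _ _ _; set S := KSink [:: 0%N; n] [:: vertex R 0].
exists (ksink_time P S), S; split=> //; split=> //=; first by rewrite n0.
move=> q; rewrite ltnS leqn0 => /eqP ->.
rewrite /in_subpath /on_path /left_of /seg_first /seg_last /= n0 lexx eqxx ?andbT /=.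
by case: (nvert P).-1.
Qed.

End Sinks.

(** * Searching in a max tree *)

Arguments upd T f i x j /.
Arguments upd2 T f a i x _ /.

Ltac step :=
  lazymatch goal with
  | |- run _ (Seq _ _) _ _ => apply: run_seq
  | |- run _ (ISet _ _) _ _ => apply: run_iset => /=
  | |- run _ (IPut _ _ _) _ _ => apply: run_iput => /=
  | |- run _ (RSet _ _) _ _ => apply: run_rset => /=
  | |- run _ (RPut _ _ _) _ _ => apply: run_rput => /=
  | |- run _ (If _ _ _) _ _ => apply: run_if => /=
  | |- run _ Skip _ _ => apply: run_skip
  end.

Ltac safe :=
  repeat lazymatch goal with
  | |- True => exact I
  | |- and3 _ _ _ => split
  | |- and _ _ => split
  | |- _ => fail
  end; rewrite /=; try lia.

(* Node [m] of a tree in heap layout is the parent of [2m] and [2m + 1]; the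
   leaves are the nodes [N, ..., 2N - 1]. *)
Definition max_tree (R : realType) (N : nat) (T : nat -> R) : Prop :=
  forall m, (0 < m < N)%N -> T m = Num.max (T (m + m)%N) (T (m + m).+1).

(** The equation on [m] says that [m] is [e] levels above the leaves and that its leftmost leaf is
    number [p]. *)
Lemma max_treeE (R : realType) N (T : nat -> R) e m p :
  max_tree N T -> (m * 2 ^ e = N + p)%N -> (p + 2 ^ e <= N)%N -> (0 < N)%N ->
  T m = range_max (fun h => T (N + h)%N) p (p + 2 ^ e).
Proof.
move=> HT; elim: e m p => [|e IH] m p.
  by rewrite expn0 muln1 addn1 => -> _ _; rewrite range_maxS // range_max_nil maxxx.
rewrite expnS => E le N0; have z0 : (0 < 2 ^ e)%N by rewrite expn_gt0.
rewrite HT; last by nia.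
rewrite (IH (m + m)%N p) //; try nia.
rewrite (IH (m + m).+1 (p + 2 ^ e)%N) //; try nia.
by rewrite -range_max_cat; [congr range_max | ]; lia.
Qed.

(* Memory layout.  Words: 2 number of segments done, 3 size N of the trees,
   4 first vertex of the segment, 5 vertex q at or to the left of the sink,
   6 position of the search, 7 current tree node, 8 its number of leaves,
   9 whether the search still climbs, 10 outcome of the last comparison.
   Reals: 1 running maximum, 2 value compared with lam, 3 left_peak,
   4 tentative running maximum, 5 lam, 6 lo, 7 hi.
   Real arrays: 4 transit, 5 load, 6 and 7 trees of lkey and rkey.
   [core] leaves out the variables assigned by the greedy algorithm, so that a
   property of [core_of s] is convertible to the one after such assignments. *)
Record core (R : realType) := Core {
  c_n : nat; c_k : nat; c_N : nat;
  c_tau : R; c_lam : R; c_lo : R; c_hi : R;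
  c_iarr : nat -> nat -> nat; c_rarr : nat -> nat -> R
}.

Definition core_of (R : realType) (s : state R) : core R :=
  Core (ivar s 0) (ivar s 1) (ivar s 3) (rvar s 0) (rvar s 5) (rvar s 6) (rvar s 7)
    (iarr s) (rarr s).

(** The variables that a comparison must preserve; word 10 and real 2 are its outcome and its
    argument. *)
Definition ilocals : seq nat := [:: 2; 4; 5; 6; 7; 8; 9]%N.
Definition rlocals : seq nat := [:: 1; 3; 4]%N.
Definition locals (R : realType) (s : state R) :=
  (map (ivar s) ilocals, map (rvar s) rlocals).

(** Tries to move past all the leaves of the current node at once, merging its maximum into the
    running one; a move to n or beyond fails without a comparison. *)
Definition try_block (T : nat) (value cmp : com) : com :=
  Seq (ISet 10 (IConst 0))
  (If (BIle (IAdd (IAdd (IVar 6) (IVar 8)) (IConst 1)) (IVar 0))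
    (Seq (If (BRle (RGet T (IVar 7)) (RVar 1))
            (RSet 4 (RVar 1)) (RSet 4 (RGet T (IVar 7))))
    (Seq value
    (Seq cmp
    (If (BIle (IConst 1) (IVar 10))
      (Seq (ISet 6 (IAdd (IVar 6) (IVar 8)))
      (Seq (ISet 7 (IAdd (IVar 7) (IConst 1)))
           (RSet 1 (RVar 4))))
      Skip))))
    Skip).

(* The blocks that start at the current position are tried in increasing size
   until one fails, which happens at the root at the latest; the second loop
   descends into the block that failed. *)
Definition search (T : nat) (value cmp : com) : com :=
  Seq (ISet 7 (IAdd (IVar 3) (IVar 6)))
  (Seq (RSet 1 (RGet T (IVar 7)))
  (Seq (ISet 8 (IConst 1))
  (Seq (ISet 9 (IConst 1))
  (Seq
    (While (BIle (IConst 1) (IVar 9))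
      (Seq
        (If (BIle (IConst 1)
              (ISub (IVar 7) (IMul (IConst 2) (IDiv (IVar 7) (IConst 2)))))
          (Seq (try_block T value cmp) (ISet 9 (IVar 10)))
          Skip)
        (If (BIle (IConst 1) (IVar 9))
          (Seq (ISet 7 (IDiv (IAdd (IVar 7) (IConst 1)) (IConst 2)))
               (ISet 8 (IAdd (IVar 8) (IVar 8))))
          Skip)))
    (While (BIle (IConst 2) (IVar 8))
      (Seq (ISet 8 (IDiv (IVar 8) (IConst 2)))
      (Seq (ISet 7 (IAdd (IVar 7) (IVar 7)))
           (try_block T value cmp)))))))).

Section Search.
Variables (R : realType) (B n k H : nat).
Local Notation N := (2 ^ H)%N.
Hypotheses (n_gt0 : (0 < n)%N) (nN : (n <= N)%N) (Nn : (N < 2 * n)%N).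
Hypothesis HB : (32 * (n + k) <= B)%N.
(* [Lam c] is the set of the values of lam that agree with the outcomes of all
   the comparisons made so far: it is a singleton in a test, and an interval that
   shrinks in the parametric search. *)
Variables (J : core R -> Prop) (Lam : core R -> R -> Prop).
Variables (cmp : com) (Tc : nat).

(** A comparison may narrow [Lam], and its outcome must be right for all the values that remain. *)
Definition cmp_spec : Prop := forall s, J (core_of s) ->
  run B cmp s (fun t s' => [/\ (t <= Tc)%N, J (core_of s'), locals s' = locals s,
    (forall lam, Lam (core_of s') lam -> Lam (core_of s) lam)
    & exists b : bool, ivar s' 10 = b /\
        forall lam, Lam (core_of s') lam -> b = (rvar s 2 <= lam)]).

Hypothesis cmpP : cmp_spec.

Variables (T : nat) (key : nat -> R).
Hypothesis sizes : forall c, J c -> c_n c = n /\ c_N c = N.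
Hypothesis tree : forall c, J c ->
  max_tree N (c_rarr c T) /\ forall h, (h < n)%N -> c_rarr c T (N + h)%N = key h.

Variables (value : com) (Tv : nat) (f : nat -> R -> R) (cnt i q p0 : nat) (M : R).
Variable Lam0 : R -> Prop.

Definition fixed (s : state R) : Prop :=
  [/\ J (core_of s), (forall lam, Lam (core_of s) lam -> Lam0 lam),
      ivar s 2 = cnt, ivar s 4 = i & ivar s 5 = q /\ rvar s 3 = M].

Hypothesis valueP : forall s, fixed s -> (ivar s 6 + ivar s 8 < n)%N ->
  run B value s (fun t s' => (t <= Tv)%N /\
    s' = set_rvar s 2 (f (ivar s 6 + ivar s 8) (rvar s 4))).

Definition block_at (s : state R) p e : Prop :=
  [/\ ivar s 6 = p, ivar s 8 = (2 ^ e)%N, (ivar s 7 * 2 ^ e = N + p)%N,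
      rvar s 1 = range_max key p0 p /\ (p0 <= p < n)%N
    & forall lam, Lam (core_of s) lam -> reaches lam key f p0 p].

Definition blocked (s : state R) p : Prop := forall lam, Lam (core_of s) lam ->
  (p < n)%N -> ~~ (f p (range_max key p0 p) <= lam).

Lemma try_blockP s p e :
  fixed s -> block_at s p e ->
  run B (try_block T value cmp) s (fun t s' =>
    [/\ (t <= Tc + Tv + 40)%N, fixed s', ivar s' 9 = ivar s 9,
        forall lam, Lam (core_of s') lam -> Lam (core_of s) lam
      & exists b : bool, ivar s' 10 = b /\
        if b then
          [/\ block_at s' (p + 2 ^ e) e, (p + 2 ^ e < n)%N
             & ivar s' 7 = (ivar s 7).+1]
        else [/\ block_at s' p e, blocked s' (p + 2 ^ e) & ivar s' 7 = ivar s 7]]).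
Proof.
move=> Fs [s6 s8 s7 [s1 /andP[p0p pn]] rch].
have [Js Ls s2 s4 [s5 s3]] := Fs; have [s0 sN] := sizes Js; rewrite /= in s0 sN.
have [Ttree Tleaf] := tree Js; rewrite /= in Ttree Tleaf.
have z0 : (0 < 2 ^ e)%N by rewrite expn_gt0.
have m_le : (ivar s 7 <= N + p)%N by rewrite -s7 leq_pmulr.
have m0 : (0 < ivar s 7)%N by case: (ivar s 7) s7 => //; lia.
have z_le : (2 ^ e <= N + p)%N by rewrite -s7 leq_pmull.
rewrite /try_block; step; step; first by lia.
step; first by rewrite s6 s8; safe.
  rewrite s6 s8 s0 addn1 => ltn_pz.
  have TE : rarr s T (ivar s 7) = range_max key p (p + 2 ^ e).
    rewrite (max_treeE Ttree s7) ?expn_gt0 //; last by lia.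
    by apply: range_max_ext => [|h hp]; rewrite Tleaf //; lia.
  set s1' := set_ivar s 10 0.
  have Hacc : run B
      (If (BRle (RGet T (IVar 7)) (RVar 1)) (RSet 4 (RVar 1)) (RSet 4 (RGet T (IVar 7))))
      s1' (fun t s' => (t <= 8)%N /\ s' = set_rvar s1' 4 (range_max key p0 (p + 2 ^ e))).
    have accE : range_max key p0 (p + 2 ^ e) = Num.max (rvar s 1) (rarr s T (ivar s 7)).
      by rewrite s1 TE -range_max_cat // p0p; lia.
    step => // cond; step => //; split=> //; rewrite accE.
      by rewrite max_l.
    by rewrite max_r // ltW // ltNge.
  step; apply: run_conseq Hacc _ => ta sa [Hta ->].
  have F2 : fixed (set_rvar s1' 4 (range_max key p0 (p + 2 ^ e))) by [].
  step; apply: run_conseq (valueP F2 _) _ => [|tv sv [Htv ->]] /=.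
    by rewrite s6 s8.
  rewrite s6 s8; set sv' := set_rvar _ 2 _.
  have Jv : J (core_of sv') by [].
  step; apply: run_conseq (cmpP Jv) _ => tc sc [Htc Jc Lc lamc [b [sc10 Hb]]].
  have [c2 c4 c5 c6 c7] : [/\ ivar sc 2 = cnt, ivar sc 4 = i, ivar sc 5 = q,
       ivar sc 6 = p & ivar sc 7 = ivar s 7] by case: Lc => -> -> -> -> ->.
  have [c8 c9] : ivar sc 8 = (2 ^ e)%N /\ ivar sc 9 = ivar s 9.
    by case: Lc => _ _ _ _ _ -> ->.
  have [r1 r3 r4] : [/\ rvar sc 1 = range_max key p0 p, rvar sc 3 = M
       & rvar sc 4 = range_max key p0 (p + 2 ^ e)].
    by case: Lc => _ _ _ _ _ _ _ -> -> ->.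
  have lamc' lam : Lam (core_of sc) lam -> Lam (core_of s) lam by move=> /lamc.
  have Fc : fixed sc by split=> // lam /lamc' /Ls.
  have [scn _] := sizes Jc; rewrite /= in scn.
  step; rewrite ?sc10 /=; first by safe.
    case: b sc10 Hb => // sc10 Hb _.
    step; step; first by rewrite c6 c8; safe.
    rewrite c6 c8; step; step; first by rewrite c7; safe.
    rewrite c7; step => //; split=> //.
      by lia.
    exists true; split=> //; split=> //; last by rewrite addn1.
    split=> //=; first by rewrite mulnDl mul1n s7 addnA.
      by rewrite r4; split=> //; lia.
    by move=> lam /Hb /esym fle; right.
  case: b sc10 Hb => // sc10 Hb _.
  step; split=> //; first by lia.
  exists false; split=> //; split=> //.
    by split=> //; rewrite ?c7 //; [split=> //; lia | move=> lam /lamc' /rch].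
  by move=> lam /Hb; rewrite /= => <-.
rewrite s6 s8 s0 addn1 -leqNgt => pz; step; split=> //; first by lia.
exists false; split=> //; split=> //.
  by split=> //; split=> //; lia.
by move=> lam _; rewrite ltnNge pz.
Qed.

(** The fuel of the climb counts the levels left up to the root, that of the descent is the height
    of the blocked node; so both loops make O(H) iterations. *)
Definition ascending fuel (s : state R) : Prop :=
  fixed s /\ exists p e, [/\ block_at s p e, (e <= H)%N
    & ivar s 9 = 1%N /\ fuel = (H - e).+1 \/
      ivar s 9 = 0%N /\ blocked s (p + 2 ^ e)].

Definition descending fuel (s : state R) : Prop :=
  fixed s /\ exists p, block_at s p fuel /\ blocked s (p + 2 ^ fuel).

Lemma searchP s :
  fixed s -> ivar s 6 = p0 -> (p0 < n)%N ->
  run B (search T value cmp) s (fun t s' =>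
    [/\ (t <= (2 * H + 3) * (Tc + Tv + 100))%N, fixed s'
      & exists p, [/\ ivar s' 6 = p, (p0 <= p < n)%N,
          rvar s' 1 = range_max key p0 p
        & forall lam, Lam (core_of s') lam -> farthest n lam key f p0 p]]).
Proof.
move=> Fs s6 p0n; have [Js Ls s2 s4 [s5 s3]] := Fs.
have [s0 sN] := sizes Js; rewrite /= in s0 sN.
have [Ttree Tleaf] := tree Js; rewrite /= in Ttree Tleaf.
have N0 : (0 < N)%N by rewrite expn_gt0.
rewrite /search; do 2! step; first by rewrite sN s6; safe.
rewrite sN s6; step; step => //; do 2! step; first by safe.
do 2! step; first by safe.
set s1 := set_ivar _ 9 1.
have I1 : ascending H.+1 s1.
  split=> //; exists p0, 0%N; split=> //; last by left; rewrite subn0.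
  split=> //; first by rewrite muln1.
    by rewrite /= Tleaf // range_max_nil leqnn.
  by left.
step; apply: (run_conseq (run_while (T := Tc + Tv + 80) _ _ I1)) => [fu s' [Fs' _]|fu s'|].
- by safe.
- move=> [Fs' [p [e [Bs' eH go]]]] /= s9.
  have [Js' Ls' s'2 s'4 [s'5 s'3]] := Fs'.
  have [s'0 s'N] := sizes Js'; rewrite /= in s'0 s'N.
  have [s'6 s'8 s'7 [s'1 p0pn'] rch] := Bs'; have /andP[p0p pn] := p0pn'.
  have {go} [s'9 fuE] : ivar s' 9 = 1%N /\ fu = (H - e).+1.
    by case: go => // -[E]; rewrite E in s9.
  have z0 : (0 < 2 ^ e)%N by rewrite expn_gt0.
  have zN : (2 ^ e <= N)%N by rewrite leq_exp2l.
  have m_le : (ivar s' 7 <= N + p)%N by rewrite -s'7 leq_pmulr.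
  rewrite fuE /=; split=> //.
  step; step; first by safe.
    move=> odd_m; step; apply: run_conseq (try_blockP Fs' Bs') _.
    move=> t2 s2' [Ht2 F2 s29 _ [b [s2b Hb]]]; step; first by [].
    rewrite s2b; case: b Hb {s2b} => Hb.
      case: Hb => B2 pzn m2; have [p2E z2 m2z [acc2 p2] rch2] := B2.
      have eH2 : (e < H)%N by rewrite -(ltn_exp2l _ _ (isT : 1 < 2)%N); lia.
      have mn : (ivar s2' 7 <= N + n)%N by rewrite m2; lia.
      step; first by safe.
        move=> _; do 2! step; first by safe.
        step; first by rewrite z2; safe.
        rewrite z2; split; first by lia.
        split=> //; exists (p + 2 ^ e)%N, e.+1; split=> //.
          split=> //=; first by rewrite expnS; lia.
          have m2E : ivar s2' 7 = ((ivar s2' 7 + 1) %/ 2 * 2)%N.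
            by rewrite m2; move: odd_m; lia.
          by rewrite expnS mulnA -m2E.
        by left; split=> //; lia.
      by [].
    step; first by safe.
      by [].
    move=> _; step; split; first by lia.
    split=> //; case: Hb => B2 bl2 _; exists p, e; split=> //.
    by right; split.
  move=> even_m; step; step; first by safe.
    move=> _; do 2! step; first by safe.
    step; first by rewrite s'8; safe.
    rewrite s'8; split; first by lia.
    have m2E : ivar s' 7 = ((ivar s' 7 + 1) %/ 2 * 2)%N by move: even_m; lia.
    (* The root is node 1, which is odd; so an even node has a parent. *)
    have eH2 : (e < H)%N.
      rewrite ltn_neqAle eH andbT; apply/eqP => Ee; move: s'7 m2E; rewrite Ee.
      case: (ivar s' 7) => [|[|m]]; rewrite ?mul0n //; nia.
    split=> //; exists p, e.+1; split=> //.
      split=> //=; first by rewrite expnS; lia.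
      by rewrite expnS mulnA -m2E.
    by left; split=> //; lia.
  by rewrite s'9.
move=> t1 s2' [Ht1 go2 [fu [F2 [p [e [B2 eH go]]]]]].
have I2 : descending e s2'.
  split=> //; exists p; split=> //.
  by case: go => -[E]; rewrite /= E // in go2.
move=> {go}.
apply: (run_conseq (run_while (T := Tc + Tv + 60) _ _ I2)) => [{}fu s' [Fs' _]|{}fu s'|].
- by safe.
- move=> {I2 B2 p} [Fs' [p [Bs' bl]]] /= z2.
  have [Js' Ls' s'2 s'4 [s'5 s'3]] := Fs'.
  have [s'0 s'N] := sizes Js'; rewrite /= in s'0 s'N.
  have [s'6 s'8 s'7 [s'1 p0pn'] rch] := Bs'; have /andP[p0p pn] := p0pn'.
  have z0 : (0 < 2 ^ fu)%N by rewrite expn_gt0.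
  have m_le : (ivar s' 7 <= N + p)%N by rewrite -s'7 leq_pmulr.
  case: fu s'8 s'7 z0 bl Bs' z2 => [|fu] s'8 s'7 z0 bl Bs' z2; first by rewrite s'8 in z2.
  split=> //.
  have z_le : (ivar s' 8 <= N + p)%N.
    by rewrite -s'7 s'8 leq_pmull //; case: (ivar s' 7) s'7 => //; lia.
  do 2! step; first by safe.
  do 2! step; first by safe.
  set s3' := set_ivar _ 7 _.
  have F3 : fixed s3' by [].
  have B3 : block_at s3' p fu.
    split=> //=; first by rewrite s'8 expnS mulKn.
    by rewrite -s'7 expnS; lia.
  apply: run_conseq (try_blockP F3 B3) _ => t2 s4' [Ht2 F4 _ lam4 [b [_ Hb]]] /=.
  split; first by lia.
  (* Either the left half is passed and the old obstacle is the end of the right half, or the end of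
     the left half is the new obstacle. *)
  split=> //; case: b Hb => -[B4 bl4 _].
    exists (p + 2 ^ fu)%N; split=> // lam; rewrite -addnA addnn -mul2n -expnS.
    by move=> /lam4; exact: bl.
  by exists p.
move=> t2 s' [Ht2 z2 {I2 B2 p} [{}fu [F' [p [B' bl]]]]].
have [s'6 s'8 s'7 [s'1 p0pn] rch] := B'.
(* The descent ends at a blocked leaf, so that [p.+1] itself is blocked. *)
case: fu s'8 bl {B' s'7} => [|fu] s'8 bl; last first.
  by move: z2; rewrite /= s'8 expnS; have := expn_gt0 2 fu; lia.
rewrite /=; split=> //.
  have : (e * (Tc + Tv + 60 + 3).+1 <= H * (Tc + Tv + 60 + 3).+1)%N by rewrite leq_mul2r eH orbT.
  move: Ht1 Ht2 => /=; lia.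
exists p; split=> // lam Hlam; split=> //; first exact: rch.
by move: (bl lam Hlam); rewrite ?expn0 addn1.
Qed.

End Search.

(** * The greedy algorithm *)

Definition left_value : com :=
  RSet 2 (RSub (RAdd (RGet 4 (IAdd (IVar 6) (IVar 8))) (RVar 4)) (RGet 5 (IVar 4))).

Definition right_value : com :=
  let load := RAdd (RVar 4) (RGet 5 (IAdd (IAdd (IVar 6) (IVar 8)) (IConst 1))) in
  let e1 := RSub load (RGet 4 (IVar 5)) in
  let e2 := RDiv (RAdd load (RVar 3)) (ROfInt (IConst 2)) in
  If (BRle e1 e2) (RSet 2 e1) (RSet 2 e2).

Definition greedy (cmp record : com) : com :=
  Seq (ISet 4 (IConst 0))
  (Seq (ISet 2 (IConst 0))
  (While (BAnd (BIle (IAdd (IVar 4) (IConst 1)) (IVar 0))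
               (BIle (IAdd (IVar 2) (IConst 1)) (IVar 1)))
    (Seq (ISet 6 (IVar 4))
    (Seq (search 6 left_value cmp)
    (Seq (ISet 5 (IVar 6))
    (Seq (If (BRle (RVar 1) (RGet 6 (IAdd (IVar 3) (IVar 5))))
            (RSet 3 (RSub (RGet 6 (IAdd (IVar 3) (IVar 5))) (RGet 5 (IVar 4))))
            (RSet 3 (RSub (RVar 1) (RGet 5 (IVar 4)))))
    (Seq (search 7 right_value cmp)
    (Seq record
    (Seq (ISet 4 (IAdd (IVar 6) (IConst 1)))
         (ISet 2 (IAdd (IVar 2) (IConst 1)))))))))))).

Section Greedy.
Variables (R : realType) (P : network R) (k B H : nat).
Hypothesis wfP : wf_network P.
Local Notation n := (nvert P).
Local Notation N := (2 ^ H)%N.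
Hypotheses (nN : (n <= N)%N) (Nn : (N < 2 * n)%N).
Hypothesis HB : (32 * (n + k) <= B)%N.

Definition tables (c : core R) : Prop :=
  [/\ c_n c = n /\ c_k c = k, c_N c = N /\ c_tau c = tau P,
      (forall h, (h <= n)%N -> c_rarr c 4 h = transit P h) /\
      (forall h, (h <= n)%N -> c_rarr c 5 h = load P h),
      max_tree N (c_rarr c 6) /\
      forall h, (h < n)%N -> c_rarr c 6 (N + h)%N = lkey P h
    & max_tree N (c_rarr c 7) /\
      forall h, (h < n)%N -> c_rarr c 7 (N + h)%N = rkey P h].

Variables (J : nat -> nat -> core R -> Prop) (Lam : core R -> R -> Prop).
Variables (cmp record : com) (Tc Tr : nat).
Hypothesis Jtables : forall r i c, J r i c -> tables c.
Hypothesis cmpP : forall r i, cmp_spec B (J r i) Lam cmp Tc.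
Hypothesis recordP : forall r i q j s,
  [/\ ivar s 2 = r, ivar s 4 = i, ivar s 5 = q, ivar s 6 = j
    & rvar s 3 = left_peak P i q] ->
  J r i (core_of s) -> (i < n)%N -> (q <= j < n)%N -> (r < k)%N ->
  (forall lam, Lam (core_of s) lam -> greedy_segment P lam i q j) ->
  run B record s (fun t s' => [/\ (t <= Tr)%N, locals s' = locals s,
    J r.+1 j.+1 (core_of s')
    & forall lam, Lam (core_of s') lam -> Lam (core_of s) lam]).

Definition search_time : nat := (2 * H + 3) * (Tc + 140).
(** Each segment covers at least one vertex, so there are at most min(k, n) of them, with two
    searches each. *)
Definition greedy_time : nat :=
  minn k n * (2 * search_time + Tr + 70) + 30.

Lemma left_searchP r i q0 M0 Lam0 s :
  fixed (J r i) Lam r i q0 M0 Lam0 s -> ivar s 6 = i -> (i < n)%N ->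
  run B (search 6 left_value cmp) s (fun t s' => [/\ (t <= search_time)%N,
    fixed (J r i) Lam r i q0 M0 Lam0 s'
    & exists q, [/\ ivar s' 6 = q, (i <= q < n)%N, rvar s' 1 = range_max (lkey P) i q
        & forall lam, Lam (core_of s') lam ->
            farthest n lam (lkey P) (left_time P i) i q]]).
Proof.
move=> Fs s6 iln; have [n0 _ _ _ _] := wfP.
have sizes c : J r i c -> c_n c = n /\ c_N c = N by move=> /Jtables[[? _] [? _]].
have tree c : J r i c -> max_tree N (c_rarr c 6) /\
    forall h, (h < n)%N -> c_rarr c 6 (N + h)%N = lkey P h.
  by move=> /Jtables[_ _ _ []].
have valueP u : fixed (J r i) Lam r i q0 M0 Lam0 u -> (ivar u 6 + ivar u 8 < n)%N ->
    run B left_value u (fun t s' => (t <= 40)%N /\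
      s' = set_rvar u 2 (left_time P i (ivar u 6 + ivar u 8) (rvar u 4))).
  move=> [Ju _ _ u4 _] lt_n; have [_ _ [uX uW] _ _] := Jtables Ju.
  rewrite /= in uX uW; rewrite /left_value; step; first by safe.
  by split=> //; rewrite u4 uX ?uW //; lia.
apply: run_conseq (searchP n0 nN Nn HB (@cmpP r i) sizes tree valueP Fs s6 iln) _.
by move=> t s' [Ht F' Hq]; split=> //; rewrite /search_time; lia.
Qed.

Lemma right_searchP r i q M Lam0 s :
  fixed (J r i) Lam r i q M Lam0 s -> ivar s 6 = q -> (q < n)%N ->
  run B (search 7 right_value cmp) s (fun t s' => [/\ (t <= search_time)%N,
    fixed (J r i) Lam r i q M Lam0 s'
    & exists j, [/\ ivar s' 6 = j, (q <= j < n)%N, rvar s' 1 = range_max (rkey P) q j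
        & forall lam, Lam (core_of s') lam ->
            farthest n lam (rkey P) (right_time P q M) q j]]).
Proof.
move=> Fs s6 qln; have [n0 _ _ _ _] := wfP.
have sizes c : J r i c -> c_n c = n /\ c_N c = N by move=> /Jtables[[? _] [? _]].
have tree c : J r i c -> max_tree N (c_rarr c 7) /\
    forall h, (h < n)%N -> c_rarr c 7 (N + h)%N = rkey P h.
  by move=> /Jtables[_ _ _ _ []].
have valueP u : fixed (J r i) Lam r i q M Lam0 u -> (ivar u 6 + ivar u 8 < n)%N ->
    run B right_value u (fun t s' => (t <= 40)%N /\
      s' = set_rvar u 2 (right_time P q M (ivar u 6 + ivar u 8) (rvar u 4))).
  move=> [Ju _ _ u4 [u5 u3]] lt_n; have [_ _ [uX uW] _ _] := Jtables Ju.
  rewrite /= in uX uW; rewrite /right_value; step; first by safe.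
    move=> cond; step; first by safe.
    split=> //; move: cond; rewrite u5 u3 addn1 uX ?uW //; try lia.
    by move=> cond; rewrite /right_time min_l.
  move=> cond; step; first by safe.
  split=> //; move: cond; rewrite u5 u3 addn1 uX ?uW //; try lia.
  by move=> cond; rewrite /right_time min_r // ltW // ltNge.
apply: run_conseq (searchP n0 nN Nn HB (@cmpP r i) sizes tree valueP Fs s6 qln) _.
by move=> t s' [Ht F' Hq]; split=> //; rewrite /search_time; lia.
Qed.

Lemma greedyP s :
  J 0 0 (core_of s) ->
  run B (greedy cmp record) s (fun t s' => (t <= greedy_time)%N /\
    exists r i, [/\ ivar s' 2 = r /\ ivar s' 4 = i, J r i (core_of s'), (r <= k)%N,
      (i < n)%N -> r = k
      & forall lam, Lam (core_of s') lam ->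
          Lam (core_of s) lam /\ greedy_chain P lam r i]).
Proof.
move=> J0; have [n0 _ _ _ _] := wfP; have [[sn sk] _ _ _ _] := Jtables J0.
pose I fuel (u : state R) := exists r i,
  [/\ ivar u 2 = r /\ ivar u 4 = i, J r i (core_of u), (i <= n)%N /\ (r <= i)%N,
      (r <= k)%N /\ fuel = (minn k n - r)%N
    & forall lam, Lam (core_of u) lam ->
          Lam (core_of s) lam /\ greedy_chain P lam r i].
rewrite /greedy; do 2! step; first by safe.
do 2! step; first by safe.
set s1 := set_ivar _ 2 0.
have I1 : I (minn k n) s1.
  exists 0%N, 0%N; split=> //=; first by rewrite subn0.
  by move=> lam Hl; split=> //; constructor.
apply: (run_conseq (run_while (T := 2 * search_time + Tr + 56) _ _ I1)) =>
    [fu u|fu u|t u [Ht go [fu [r [i [[u2 u4] Ju [iln _] [rk _] Hl]]]]]].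
- move=> [r [i [[u2 u4] Ju [iln _] [rk _] _]]]; rewrite /= u2 u4.
  by safe.
- move=> [r [i [[u2 u4] Ju [iln ri] [rk Ef] Hl]]] /=.
  have [[un uk] [uN _] [uX uW] [uT6 uL6] _] := Jtables Ju; rewrite /= in un uk uN.
  rewrite u2 u4 un uk !addn1 => /andP[ilt rlt].
  split; first by lia.
  do 2! step; first by safe.
  set u1 := set_ivar u 6 _.
  (* The chain built so far is carried through the search by the parameter [Lam0]. *)
  have F1 : fixed (J r i) Lam r i (ivar u 5) (rvar u 3)
      (fun lam => Lam (core_of s) lam /\ greedy_chain P lam r i) u1 by [].
  step; apply: run_conseq (left_searchP F1 u4 ilt) _ => t2 u2' [Ht2 F2 [q [q6 iqn acc far]]].
  have [J2 L2 u22 u24 _] := F2; have [[vn vk] [vN _] [vX vW] [_ vL6] _] := Jtables J2.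
  rewrite /= in vn vk vN vW vL6.
  have /andP[iq qn] := iqn.
  do 2! step; first by safe.
  set u3 := set_ivar u2' 5 _; set M := left_peak P i q.
  have run3 : run B
    (If (BRle (RVar 1) (RGet 6 (IAdd (IVar 3) (IVar 5))))
            (RSet 3 (RSub (RGet 6 (IAdd (IVar 3) (IVar 5))) (RGet 5 (IVar 4))))
            (RSet 3 (RSub (RVar 1) (RGet 5 (IVar 4))))) u3
    (fun t s' => (t <= 20)%N /\ s' = set_rvar u3 3 M).
    (* The search leaves the maximum over [i, q); the peak includes v_q too. *)
    have ME : M = Num.max (rvar u2' 1) (rarr u2' 6 (N + q)%N) - rarr u2' 5 i.
      by rewrite /M /left_peak acc vL6 // vW ?range_maxS // ltnW.
    step; first by safe.
      rewrite vN q6 => cond; step; first by safe.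
      by split=> //; rewrite vN q6 u24 ME max_r.
    rewrite vN q6 => cond; step; first by safe.
    by split=> //; rewrite u24 ME max_l // ltW // ltNge.
  step; apply: run_conseq run3 _ => t3 _ [Ht3 ->].
  set u4' := set_rvar u3 3 M.
  have F4 : fixed (J r i) Lam r i q M (Lam (core_of u2')) u4' by split=> //; rewrite /= q6.
  step; apply: run_conseq (right_searchP F4 q6 qn) _ => t5 u5 [Ht5 F5 [j [j6 qjn _ far5]]].
  have [J5 L5 u52 u54 [u55 u53]] := F5.
  have R5 : [/\ ivar u5 2 = r, ivar u5 4 = i, ivar u5 5 = q, ivar u5 6 = j
      & rvar u5 3 = left_peak P i q] by [].
  have G5 lam : Lam (core_of u5) lam -> greedy_segment P lam i q j.
    by move=> Hlam; split; [apply/far/L5 | apply: far5].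
  step; apply: run_conseq (recordP R5 J5 ilt qjn rlt G5) _ => t6 u6 [Ht6 E6 J6 L6].
  have [u62 u66] : ivar u6 2 = r /\ ivar u6 6 = j by case: E6 => -> _ _ ->.
  do 2! step; first by rewrite u66; safe.
  step; first by rewrite u62; safe.
  rewrite u66 u62; split; first by lia.
  exists r.+1, j.+1; split=> //=; rewrite ?addn1 //; try by lia.
  move=> lam /L6 Hlam; have [Hs Hc] := L2 _ (L5 _ Hlam).
  by split=> //; apply: greedy_chainS Hc ilt (G5 _ Hlam).
have [[un uk] _ _ _ _] := Jtables Ju; rewrite /= in un uk.
rewrite /=; split; first by move: Ht => /=; rewrite /greedy_time; lia.
exists r, i; split=> // iltn; move: go; rewrite /= u2 u4 un uk; lia.
Qed.

End Greedy.

(** * Parametric search *)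

Fixpoint iwrites (p : com) : seq nat :=
  match p with
  | ISet x _ => [:: x]
  | Seq p1 p2 | If _ p1 p2 => iwrites p1 ++ iwrites p2
  | While _ p1 => iwrites p1
  | _ => [::]
  end.

Fixpoint rwrites (p : com) : seq nat :=
  match p with
  | RSet x _ => [:: x]
  | Seq p1 p2 | If _ p1 p2 => rwrites p1 ++ rwrites p2
  | While _ p1 => rwrites p1
  | _ => [::]
  end.

(** This protects the copies made by [save], and the bounds lo and hi, from a nested test. *)
Lemma exec_frame (R : realType) B p (s : state R) t s' :
  exec B p s t s' ->
  (forall x, x \notin iwrites p -> ivar s' x = ivar s x) /\
  (forall x, x \notin rwrites p -> rvar s' x = rvar s x).
Proof.
elim=> //=.
- by move=> {}s x e v _; split=> // y; rewrite inE /= => /negbTE ->.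
- by move=> {}s x e v _; split=> // y; rewrite inE /= => /negbTE ->.
- move=> p1 p2 {}s s1 s2 t1 t2 _ [I1 R1] _ [I2 R2]; split=> x;
    rewrite mem_cat negb_or => /andP[x1 x2]; first by rewrite I2 ?I1.
  by rewrite R2 ?R1.
- move=> b p1 p2 {}s {}s' {}t [] _ _ [I1 R1]; split=> x;
    rewrite mem_cat negb_or => /andP[x1 x2]; by rewrite ?I1 ?R1.
- move=> b p1 {}s s1 s2 t1 t2 _ _ [I1 R1] _ [I2 R2]; split=> x xp.
    by rewrite I2 ?I1.
  by rewrite R2 ?R1.
Qed.

Lemma run_frame (R : realType) B p (s : state R) Q :
  run B p s Q -> run B p s (fun t s' => Q t s' /\
    ((forall x, x \notin iwrites p -> ivar s' x = ivar s x) /\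
     (forall x, x \notin rwrites p -> rvar s' x = rvar s x))).
Proof.
move=> [t [s' [E q]]]; exists t, s'; split=> //; split=> //.
exact: exec_frame E.
Qed.

Definition compare : com :=
  If (BRle (RVar 2) (RVar 5)) (ISet 10 (IConst 1)) (ISet 10 (IConst 0)).

(** The boundary j_0 is not written: it is the initial 0 of the memory, whence the hypotheses on
    [iarr s 0 0] below. *)
Definition record : com :=
  Seq (IPut 0 (IAdd (IVar 2) (IConst 1)) (IAdd (IVar 6) (IConst 1)))
  (Seq (IPut 1 (IVar 2) (IVar 5))
  (If (BAnd (BIle (IAdd (IVar 5) (IConst 1)) (IVar 6))
            (BNot (BRle (RVar 5) (RAdd (RVar 3) (RGet 4 (IVar 5))))))
    (RPut 3 (IVar 2)
      (RDiv (RSub (RSub (RVar 5) (RVar 3)) (RGet 4 (IVar 5))) (RVar 0)))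
    (RPut 3 (IVar 2) (ROfInt (IConst 0))))).

Definition test : com := greedy compare record.

(* A test run inside the parametric search overwrites its local variables. *)
Definition save : com :=
  foldr (fun x => Seq (ISet (x + 20) (IVar x)))
    (foldr (fun x => Seq (RSet (x + 20) (RVar x))) Skip rlocals) ilocals.

Definition restore : com :=
  foldr (fun x => Seq (ISet x (IVar (x + 20))))
    (foldr (fun x => Seq (RSet x (RVar (x + 20)))) Skip rlocals) ilocals.

(** Compares the value v in real 2 with the unknown lam in [lo, hi). Outside (lo, hi) the answer is
    known; otherwise v is tested and becomes hi if feasible (then lam < v) or lo if not (then v <=
    lam). *)
Definition bisect : com :=
  If (BRle (RVar 2) (RVar 6)) (ISet 10 (IConst 1))
  (If (BAnd (BNot (BRle (RVar 7) (ROfInt (IConst 0)))) (BRle (RVar 7) (RVar 2)))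
    (ISet 10 (IConst 0))
    (Seq (RSet 5 (RVar 2))
    (Seq save
    (Seq test
    (Seq (If (BIle (IVar 0) (IVar 4))
           (Seq (RSet 7 (RVar 5)) (ISet 10 (IConst 0)))
           (Seq (RSet 6 (RVar 5)) (ISet 10 (IConst 1))))
         restore))))).

(** Time 0 is tested first: if it is infeasible, it can serve as the initial lo, and hi = 0 is free
    to mean that there is no upper bound yet. The final test at hi writes the output. *)
Definition optimize : com :=
  Seq (RSet 5 (ROfInt (IConst 0)))
  (Seq test
  (If (BIle (IVar 0) (IVar 4)) Skip
    (Seq (RSet 6 (ROfInt (IConst 0)))
    (Seq (RSet 7 (ROfInt (IConst 0)))
    (Seq (greedy bisect Skip)
    (Seq (RSet 5 (RVar 7)) test)))))).

Section Optimize.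
Variables (R : realType) (P : network R) (k B H : nat).
Hypotheses (wfP : wf_network P) (unif : uniform_capacity P) (k_gt0 : (0 < k)%N).
Local Notation n := (nvert P).
Local Notation N := (2 ^ H)%N.
Hypotheses (nN : (n <= N)%N) (Nn : (N < 2 * n)%N).
Hypothesis HB : (32 * (n + k) <= B)%N.

Definition recorded (r : nat) (c : core R) : ksink R :=
  KSink (mkseq (c_iarr c 0) r.+1) (mkseq (fun q => (c_iarr c 1 q, c_rarr c 3 q)) r).

Definition test_inv lam r i (c : core R) : Prop :=
  [/\ tables P k H c, c_lam c = lam & prefix_ksink P lam r i (recorded r c)].

Definition test_lam (c : core R) (l : R) : Prop := l = c_lam c.

Lemma compareP lam r i : cmp_spec B (test_inv lam r i) test_lam compare 10.
Proof.
have n0 : (0 < n)%N by case: wfP.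
move=> s Js; rewrite /compare; step => // cond; step; try by safe.
  by split=> //; exists true; split=> // l ->; rewrite /= cond.
by split=> //; exists false; split=> // l ->; rewrite /= (negbTE cond).
Qed.

Lemma mkseq_upd (T : Type) (g : nat -> T) r x m :
  (m <= r)%N -> mkseq (upd g r x) m = mkseq g m.
Proof.
move=> mr; apply/eq_in_map => h; rewrite mem_iota => /andP[_ hm] /=.
by rewrite ltn_eqF //; lia.
Qed.

Lemma recordP lam r i q j s : 0 <= lam ->
  [/\ ivar s 2 = r, ivar s 4 = i, ivar s 5 = q, ivar s 6 = j
    & rvar s 3 = left_peak P i q] ->
  test_inv lam r i (core_of s) -> (i < n)%N -> (q <= j < n)%N -> (r < k)%N ->
  (forall l, test_lam (core_of s) l -> greedy_segment P l i q j) ->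
  run B record s (fun t s' => [/\ (t <= 50)%N, locals s' = locals s,
    test_inv lam r.+1 j.+1 (core_of s')
    & forall l, test_lam (core_of s') l -> test_lam (core_of s) l]).
Proof.
move=> lam0 [s2 s4 s5 s6 s3] [Ts sl Ps] iln /andP[qj jn] rk G.
have Glam : greedy_segment P lam i q j by exact: G.
have [[sn sk] [sN st] [sX sW] sT6 sT7] := Ts.
rewrite /= in sn sk sN st sX sW sl sT6 sT7.
pose off := greedy_offset P lam i q j.
pose s' := set_rarr (set_iarr (set_iarr s 0 r.+1 j.+1) 1 r q) 3 r off.
have post : test_inv lam r.+1 j.+1 (core_of s').
  split=> //.
  have -> : recorded r.+1 (core_of s') =
      KSink (rcons (bounds (recorded r (core_of s))) j.+1)
            (rcons (sinks (recorded r (core_of s))) (q, off)).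
    congr KSink.
      rewrite -[LHS]/(mkseq (upd (iarr s 0) r.+1 j.+1) r.+2) mkseqS mkseq_upd //.
      by congr rcons; rewrite /= eqxx.
    rewrite mkseqS; congr rcons; last by rewrite /= !eqxx.
    apply/eq_in_map => h; rewrite mem_iota => /andP[_ hr] /=.
    by rewrite ltn_eqF.
  exact: prefix_ksink_rcons lam0 Ps Glam.
rewrite /record; step; step; first by rewrite s2; safe.
  by rewrite s6; safe.
rewrite s2 s6 !addn1; step; step => //; rewrite s2 s5.
set u := set_iarr _ 1 r q.
step; first by rewrite s5; safe.
  rewrite s5 s6 s3 sX ?sl; last by lia.
  move=> cond; step => //; split=> //.
  rewrite s2 s3 s5 sl st sX; last by lia.
  suff -> : (lam - left_peak P i q - transit P q) / tau P = off by [].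
  by rewrite /off /greedy_offset -[(q < j)%N]/(q.+1 <= j)%N -addn1 ltNge cond.
rewrite s5 s6 s3 sX ?sl; last by lia.
move=> cond; step => //.
split=> //; rewrite s2; suff -> : 0%:R = off by [].
by rewrite /off /greedy_offset -[(q < j)%N]/(q.+1 <= j)%N -addn1 ltNge (negbTE cond).
Qed.

Definition test_time : nat := greedy_time P k H 10 50.

Lemma testP s :
  tables P k H (core_of s) -> iarr s 0 0 = 0%N -> 0 <= rvar s 5 ->
  run B test s (fun t s' => [/\ (t <= test_time)%N, tables P k H (core_of s'),
    iarr s' 0 0 = 0%N,
    (n <= ivar s' 4)%N ->
      is_ksink P k (output_ksink s') /\ ksink_time P (output_ksink s') <= rvar s 5
    & (ivar s' 4 < n)%N -> ~ feasible P k (rvar s 5)] /\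
    ((forall x, x \notin iwrites test -> ivar s' x = ivar s x) /\
     (forall x, x \notin rwrites test -> rvar s' x = rvar s x))).
Proof.
move=> Ts s00 lam0; apply: run_frame; set lam := rvar s 5 in lam0 *.
have J0 : test_inv lam 0 0 (core_of s) by split=> //; split=> //=; rewrite s00.
have Jt r i c : test_inv lam r i c -> tables P k H c by case.
have recP r i q j := @recordP lam r i q j ^~ lam0.
apply: run_conseq (greedyP wfP nN Nn HB Jt (@compareP lam) recP J0) _.
move=> t s' [Ht [r [i [[s2 s4] [T' l' P'] rk irk Hl]]]].
have [_ ch] : test_lam (core_of s) lam /\ greedy_chain P lam r i by exact/Hl/esym.
have iln := greedy_chain_le ch.
split=> //; first by case: P' => _ [/=].
  rewrite s4 => ni; have Ein : i = n by apply/eqP; rewrite eqn_leq iln.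
  rewrite Ein in P'; have -> : output_ksink s' = recorded r (core_of s').
    by rewrite /output_ksink s2.
  exact: prefix_ksinkT lam0 rk P'.
rewrite s4 => ilt; exact: (greedy_chain_feasible wfP unif lam0 ch rk ilt (or_introl (irk ilt))).
Qed.

Definition bisect_inv (r i : nat) (c : core R) : Prop :=
  [/\ tables P k H c, c_iarr c 0 0 = 0%N, 0 <= c_lo c, ~ feasible P k (c_lo c)
    & 0 < c_hi c -> feasible P k (c_hi c)].

(* [c_hi c <= 0] encodes that no feasible time has been found yet. *)
Definition bisect_lam (c : core R) (l : R) : Prop :=
  c_lo c <= l /\ (0 < c_hi c -> l < c_hi c).

Lemma bisectP r i :
  cmp_spec B (bisect_inv r i) bisect_lam bisect (test_time + 100).
Proof.
move=> s [Ts s00 lo0 lo_inf hi_fea]; have n0 : (0 < n)%N by case: wfP.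
rewrite /= in s00 lo0 lo_inf hi_fea.
rewrite /bisect; step=> // [v_lo|].
  step; first by safe.
  split=> //; first by lia.
  by exists true; split=> // l [lo_l _]; rewrite (le_trans v_lo).
rewrite -ltNge => lo_v; step; first by safe.
  rewrite -ltNge => /andP[hi0 hi_v]; step; first by safe.
  split=> //; first by lia.
  exists false; split=> // l [_ /(_ hi0) lhi]; apply/esym/negbTE; rewrite -ltNge.
  exact: lt_le_trans hi_v.
rewrite -ltNge negb_and -leNgt -ltNge => hiv.
do 2! step => //; step; rewrite /save /=; do 10! (step; step=> //); step.
set s1 := set_rvar _ 24 _.
have lam0 : 0 <= rvar s1 5 by rewrite /= (le_trans lo0) // ltW.
have T1 : tables P k H (core_of s1) by [].
step; apply: run_conseq (testP T1 s00 lam0) _ => t s2 [[Ht T2 s2_00 yes no] [fI fR]].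
have [[s20 _] _ _ _ _] := T2; rewrite /= in s20.
have keepI x : x \notin iwrites test -> ivar s2 x = ivar s1 x by exact: fI.
have keepR x : x \notin rwrites test -> rvar s2 x = rvar s1 x by exact: fR.
have s26 : rvar s2 6 = rvar s 6 by rewrite keepR.
have s27 : rvar s2 7 = rvar s 7 by rewrite keepR.
have s25 : rvar s2 5 = rvar s 2 by rewrite keepR.
have restoreP u : tables P k H (core_of u) ->
    [seq ivar u (x + 20) | x <- ilocals]%N = [seq ivar s2 (x + 20) | x <- ilocals]%N ->
    [seq rvar u (x + 20) | x <- rlocals]%N = [seq rvar s2 (x + 20) | x <- rlocals]%N ->
    run B restore u (fun t s' => [/\ (t <= 21)%N, locals s' = locals s,
      core_of s' = core_of u & ivar s' 10 = ivar u 10]).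
  move=> Tu uI uR; rewrite /restore /=; do 10! (step; step=> //); step.
  case: uI => i1 i2 i3 i4 i5 i6 i7; case: uR => r1 r2 r3.
  split=> //; rewrite /locals /= i1 i2 i3 i4 i5 i6 i7 r1 r2 r3.
  by rewrite !keepI // !keepR.
step; step=> //; rewrite s20 => fea.
  step; step=> //; step; first by safe.
  set u := set_ivar _ 10 0; apply: run_conseq (@restoreP u _ _ _) _ => //.
  move=> t' s' [Ht' El Ec E10]; split=> //; rewrite ?Ec ?E10.
  - by lia.
  - split=> //=; first by rewrite s26.
      by rewrite s26.
    by move=> _; rewrite s25; eexists; exact: yes fea.
  - move=> l [/= lo_l lhi]; rewrite s26 in lo_l; rewrite s25 in lhi.
    (* As v > lo >= 0, the new hi is positive and thus a genuine upper bound. *)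
    have {}lhi : l < rvar s 2 by apply: lhi; exact: le_lt_trans lo_v.
    split=> // hi0; move: hiv; rewrite leNgt hi0 /=; exact: lt_trans.
  - exists false; split=> // l [/= _]; rewrite s25 => lhi.
    by apply/esym/negbTE; rewrite -ltNge; apply: lhi; exact: le_lt_trans lo_v.
rewrite -ltnNge in fea.
step; step=> //; step; first by safe.
set u := set_ivar _ 10 1; apply: run_conseq (@restoreP u _ _ _) _ => //.
move=> t' s' [Ht' El Ec E10]; split=> //; rewrite ?Ec ?E10.
- by lia.
- split=> //=; rewrite ?s25 ?s27 //; exact: no.
- move=> l [/= lo_l lhi]; rewrite s25 in lo_l; rewrite s27 in lhi.
  by split=> //; rewrite /= (le_trans (ltW lo_v)).
- by exists true; split=> // l [/= lo_l _]; rewrite s25 in lo_l.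
Qed.

Definition optimize_time : nat :=
  2 * test_time + greedy_time P k H (test_time + 100) 1 + 30.

Lemma optimizeP s :
  tables P k H (core_of s) -> iarr s 0 0 = 0%N ->
  run B optimize s (fun t s' => (t <= optimize_time)%N /\
    optimal_ksink P k (output_ksink s')).
Proof.
move=> Ts s00; have n0 : (0 < n)%N by case: wfP.
rewrite /optimize; do 2! step; first by safe.
set s1 := set_rvar _ 5 _.
have T1 : tables P k H (core_of s1) by [].
step; apply: run_conseq (testP T1 s00 (lexx 0)) _ => t2 s2 [[Ht2 T2 s2_00 yes2 no2] _].
have [[s20 _] _ _ _ _] := T2; rewrite /= in s20.
step=> //; rewrite s20 => fea2.
  step; split; first by rewrite /optimize_time; lia.
  have [ks tm] := yes2 fea2; split=> // S' _.
  exact: le_trans tm (ksink_time_ge0 P S').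
rewrite -ltnNge in fea2; have {no2 yes2} no0 := no2 fea2.
do 2! step; first by safe.
do 2! step; first by safe.
set s3 := set_rvar _ 7 _.
have J3 : bisect_inv 0 0 (core_of s3).
  by split=> //=; rewrite ltxx.
have Jt r i c : bisect_inv r i c -> tables P k H c by case.
have recP r i q j u :
    [/\ ivar u 2 = r, ivar u 4 = i, ivar u 5 = q, ivar u 6 = j
      & rvar u 3 = left_peak P i q] ->
    bisect_inv r i (core_of u) -> (i < n)%N -> (q <= j < n)%N -> (r < k)%N ->
    (forall lam, bisect_lam (core_of u) lam -> greedy_segment P lam i q j) ->
    run B Skip u (fun t s' => [/\ (t <= 1)%N, locals s' = locals u,
      bisect_inv r.+1 j.+1 (core_of s')
      & forall lam, bisect_lam (core_of s') lam -> bisect_lam (core_of u) lam]).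
  by move=> _ Ju _ _ _ _; step.
step; apply: run_conseq (greedyP wfP nN Nn HB Jt bisectP recP J3) _.
move=> t4 s4 [Ht4 [r [i [_ [T4 s4_00 lo0 lo_inf hi_fea] rk irk Hl]]]].
rewrite /= in s4_00 lo0 lo_inf hi_fea.
set lo := rvar s4 6 in lo0 lo_inf; set hi := rvar s4 7 in hi_fea.
have mono lam lam' : lam <= lam' -> feasible P k lam -> feasible P k lam'.
  exact: feasible_mono.
have lo_lam : bisect_lam (core_of s4) lo.
  split=> // hi0; rewrite ltNge; apply/negP => hilo.
  by apply: lo_inf; apply: mono hilo _; exact: hi_fea.
have [_ ch_lo] := Hl _ lo_lam.
(* The chain is valid for lo; if it reached n, it would give a k-sink within lo. *)
have ilt : (i < n)%N.
  rewrite ltnNge; apply/negP => ni; have iln := greedy_chain_le ch_lo.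
  have [S HS] := greedy_chain_prefix wfP unif lo0 ch_lo.
  apply: lo_inf; exists S; apply: (prefix_ksinkT lo0 rk).
  by have <- : i = n by apply/eqP; rewrite eqn_leq iln.
have infeasible l : bisect_lam (core_of s4) l -> ~ feasible P k l.
  move=> Hlam; have [_ ch] := Hl _ Hlam; have [/(le_trans lo0) l0 _] := Hlam.
  by apply: (greedy_chain_feasible wfP unif l0 ch rk ilt); left; exact: irk.
(* Without an upper bound, the remaining values would include a feasible one. *)
have hi0 : 0 < hi.
  rewrite ltNge; apply/negP => hi_le0; have [l0 Hl0] := ex_feasible wfP k_gt0.
  apply: (@infeasible (Num.max lo l0)); last by apply: mono Hl0; rewrite le_max lexx orbT.
  by split; [rewrite /= le_max lexx | rewrite ltNge /= hi_le0].
do 2! step => //; set s5 := set_rvar _ 5 _.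
have T5 : tables P k H (core_of s5) by [].
apply: run_conseq (testP T5 s4_00 (ltW hi0)) _ => t6 s6 [[Ht6 T6 s6_00 yes6 no6] _].
have fea6 : (n <= ivar s6 4)%N.
  by rewrite leqNgt; apply/negP => /no6; apply; exact: hi_fea.
have [ks tm] := yes6 fea6; split; first by rewrite /optimize_time; lia.
split=> // S' HS'; apply: le_trans tm _; rewrite leNgt; apply/negP => lt_hi.
have feaS' : feasible P k (ksink_time P S') by exists S'.
apply: (@infeasible (ksink_time P S')) => //; split=> //=.
by rewrite leNgt; apply/negP => lt_lo; apply: lo_inf; apply: mono (ltW lt_lo) _.
Qed.

End Optimize.

(** * Preprocessing *)

Definition find_size : com :=
  Seq (ISet 3 (IConst 1))
  (While (BIle (IAdd (IVar 3) (IConst 1)) (IVar 0)) (ISet 3 (IAdd (IVar 3) (IVar 3)))).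

(** At h = n - 1 the missing edge length is read as 0, in agreement with [transit]. Leaves from n on
    keep the value 0; [try_block] reads only nodes whose leaves are all below n. *)
Definition fill_tables : com :=
  let h := IVar 11 in let h1 := IAdd (IVar 11) (IConst 1) in
  Seq (RSet 8 (RGet 2 (IConst 0)))
  (Seq (ISet 11 (IConst 0))
  (While (BIle h1 (IVar 0))
    (Seq (RPut 5 h1 (RAdd (RGet 5 h) (RDiv (RGet 0 h) (RVar 8))))
    (Seq (RPut 4 h1 (RAdd (RGet 4 h) (RMul (RGet 1 h) (RVar 0))))
    (Seq (RPut 6 (IAdd (IVar 3) h) (RSub (RGet 5 h1) (RGet 4 h)))
    (Seq (RPut 7 (IAdd (IVar 3) h) (RSub (RGet 4 h1) (RGet 5 h1)))
         (ISet 11 h1))))))).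

Definition build_node (T : nat) : com :=
  let l := RGet T (IAdd (IVar 11) (IVar 11)) in
  let r := RGet T (IAdd (IAdd (IVar 11) (IVar 11)) (IConst 1)) in
  If (BRle l r) (RPut T (IVar 11) r) (RPut T (IVar 11) l).

Definition build_trees : com :=
  Seq (ISet 11 (IVar 3))
  (While (BIle (IConst 2) (IVar 11))
    (Seq (ISet 11 (ISub (IVar 11) (IConst 1)))
    (Seq (build_node 6) (build_node 7)))).

Definition main : com :=
  Seq find_size (Seq fill_tables (Seq build_trees optimize)).

Section Preprocessing.
Variables (R : realType) (P : network R) (k B : nat).
Hypothesis (wfP : wf_network P).
Local Notation n := (nvert P).
Local Notation c := (nth 0 (caps P) 0).
Hypothesis HB : (32 * (n + k) <= B)%N.

(** 2^H is the least power of 2 that is at least n; H = 0 is apart because [0.-1] is 0. *)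
Definition log_size H : Prop :=
  [/\ (n <= 2 ^ H)%N, (2 ^ H < 2 * n)%N & (2 ^ H.-1 < n)%N \/ H = 0%N].

Lemma find_sizeP :
  run B find_size (input_state P k) (fun t s => (t <= 15 * n + 15)%N /\
    exists H, [/\ log_size H, ivar s 3 = (2 ^ H)%N,
      [/\ ivar s 0 = n & ivar s 1 = k], rvar s 0 = tau P
      & iarr s = iarr (input_state P k) /\ rarr s = rarr (input_state P k)]).
Proof.
have n0 : (0 < n)%N by case: wfP.
(* Each doubling gains at least 1; the resulting linear bound suffices. *)
pose I f s := exists e, [/\ (n <= 2 ^ e + f)%N, (2 ^ e < 2 * n)%N /\
    ((2 ^ e.-1 < n)%N \/ e = 0%N), ivar s 3 = (2 ^ e)%N,
      [/\ ivar s 0 = n, ivar s 1 = k & rvar s 0 = tau P]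
    & iarr s = iarr (input_state P k) /\ rarr s = rarr (input_state P k)].
rewrite /find_size; do 2! step; first by safe.
set s1 := set_ivar _ 3 1; have I1 : I n s1.
  by exists 0%N; split; rewrite ?expn0 //; split; [lia | right].
apply: (run_conseq (run_while (T := 4) _ _ I1)) => [f s|f s|t s [Ht go [f Is]]].
- move=> [e [_ [e1 _] s3 [s0 _ _] _]]; rewrite /= s3; safe.
- move=> [e [nf [e1 e2] s3 [s0 sk st] ar]] /=; rewrite s3 s0 => en; split; first by lia.
  have z0 : (0 < 2 ^ e)%N by rewrite expn_gt0.
  step; first by rewrite s3; safe.
  split=> //; exists e.+1; rewrite expnS; split=> //=; lia.
- case: Is => [e [nf [e1 e2] s3 [s0 sk st] ar]].
  split; first by move: Ht => /=; lia.
  exists e; split=> //; split=> //; move: go; rewrite /= s3 s0; lia.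
Qed.

Definition filled H h (s : state R) : Prop :=
  [/\ ivar s 3 = (2 ^ H)%N /\ rvar s 0 = tau P, ivar s 0 = n /\ ivar s 1 = k,
      iarr s 0 0 = 0%N,
      (forall g, (g <= h)%N -> rarr s 4 g = transit P g) /\
      (forall g, (g <= h)%N -> rarr s 5 g = load P g)
    & (forall g, (g < h)%N -> rarr s 6 (2 ^ H + g)%N = lkey P g) /\
      (forall g, (g < h)%N -> rarr s 7 (2 ^ H + g)%N = rkey P g)].

Lemma fill_tablesP H s :
  log_size H -> ivar s 3 = (2 ^ H)%N -> ivar s 0 = n -> ivar s 1 = k ->
  rvar s 0 = tau P ->
  iarr s = iarr (input_state P k) -> rarr s = rarr (input_state P k) ->
  run B fill_tables s (fun t s' => (t <= 60 * n + 15)%N /\ filled H n s').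
Proof.
move=> [nN Nn _] s3 s0 sk st sI sR; have n0 : (0 < n)%N by case: wfP.
rewrite /fill_tables; do 2! step; first by safe.
do 2! step; first by safe.
set s1 := set_ivar _ 11 0.
pose I f u := exists h, [/\ ivar u 11 = h, (f + h = n)%N, filled H h u, rvar u 8 = c
  & rarr u 0 = [eta nth 0 [seq w%:R | w <- weights P]] /\ rarr u 1 = [eta nth 0 (lengths P)]].
have I1 : I n s1.
  exists 0%N; split; rewrite ?addn0 //=.
  - split=> //=; first by rewrite sI.
    by rewrite sR; split=> -[|//] _; rewrite /= /transit /load ?big_geq //= ?mul0r.
  - by rewrite sR.
  - by rewrite sR.
apply: (run_conseq (run_while (T := 54) _ _ I1)) => [f u|f u|t u [Ht go [f Iu]]].
- move=> [h [u11 fh [_ [u0 _] _ _ _] _ _]]; rewrite /= u11; safe.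
- move=> [h [u11 fh [[u3 ut] [u0 uk] u00 [uX uW] [uL uR]] u8 [uw ul]]] /=.
  rewrite u11 u0 addn1 => hn; split; first by lia.
  do 2! step; try by rewrite ?u11; safe.
  do 2! step; try by rewrite ?u11; safe.
  do 2! step; try by rewrite ?u11 ?u3; safe.
  do 2! step; try by rewrite ?u11 ?u3; safe.
  step; first by rewrite u11; safe.
  rewrite u11 u3 !addn1 !eqxx u8 ut uw ul ltn_eqF // (nth_map 0%N) //.
  rewrite uX // uW // -loadS -transitS.
  split=> //; exists h.+1; split=> //=; first by lia.
  split=> //=; split=> g; rewrite ?ltnS ?eqn_add2l.
  + by case: eqP => [-> //|ne] gh; rewrite uX //; lia.
  + by case: eqP => [-> //|ne] gh; rewrite uW //; lia.
  + by case: eqP => [-> //|ne] gh; rewrite uL //; lia.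
  + by case: eqP => [-> //|ne] gh; rewrite uR //; lia.
- case: Iu => [h [u11 fh Fu _ _]]; split; first by move: Ht => /=; lia.
  have [_ [u0 _] _ _ _] := Fu; move: go; rewrite /= u11 u0 => go.
  by have -> : n = h by lia.
Qed.

Lemma build_nodeP H T m (s : state R) :
  ivar s 11 = m -> (m < 2 ^ H)%N -> (2 ^ H < 2 * n)%N ->
  run B (build_node T) s (fun t s' => (t <= 20)%N /\
    s' = set_rarr s T m (Num.max (rarr s T (m + m)%N) (rarr s T (m + m).+1))).
Proof.
move=> s11 mN Nn; rewrite /build_node; step; first by rewrite s11; safe.
  rewrite s11 addn1 => cond; step; first by safe.
    by rewrite s11; safe.
  by split=> //; rewrite s11 addn1 max_r.
rewrite s11 addn1 => cond; step; first by safe.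
  by rewrite s11; safe.
by split=> //; rewrite s11 max_l // ltW // ltNge.
Qed.

Lemma build_treesP H s :
  log_size H -> filled H n s ->
  run B build_trees s (fun t s' => [/\ (t <= 110 * n + 15)%N,
    tables P k H (core_of s') & iarr s' 0 0 = 0%N]).
Proof.
move=> [nN Nn _] Fs; have n0 : (0 < n)%N by case: wfP.
have [[s3 _] _ _ _ _] := Fs; have N0 : (0 < 2 ^ H)%N by rewrite expn_gt0.
rewrite /build_trees; do 2! step => //; rewrite s3.
set s1 := set_ivar _ 11 _.
pose subtree h (T : nat -> R) := forall m, (h <= m < 2 ^ H)%N ->
  T m = Num.max (T (m + m)%N) (T (m + m).+1).
pose I f u := exists h, [/\ ivar u 11 = h, (0 < h <= 2 ^ H)%N /\ (f = h.-1)%N,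
  filled H n u, subtree h (rarr u 6) & subtree h (rarr u 7)].
have I1 : I (2 ^ H).-1 s1.
  by exists (2 ^ H)%N; split=> //; rewrite ?N0 ?leqnn //; move=> m; case: ltngtP; lia.
apply: (run_conseq (run_while (T := 46) _ _ I1)) => [f u|f u|t u [Ht go [f Iu]]].
- by move=> [h [u11 _ _ _ _]]; safe.
- move=> [h [u11 [/andP[h0 hN] fE] Fu t6 t7]] /=; rewrite u11 => h2; split; first by lia.
  do 2! step; first by rewrite u11; safe.
  rewrite u11; set u1 := set_ivar u 11 _.
  have mN : (h - 1 < 2 ^ H)%N by lia.
  step; apply: run_conseq (@build_nodeP H 6 (h - 1) u1 erefl mN Nn) _ => ta _ [Ha ->].
  set u2 := set_rarr u1 6 _ _.
  apply: run_conseq (@build_nodeP H 7 (h - 1) u2 erefl mN Nn) _ => tb _ [Hb ->].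
  split; first by lia.
  have [[u3 ut] [u0 uk] u00 uXW [uL uR]] := Fu.
  exists (h - 1)%N; split=> //=; first by lia.
  + split=> //=; split=> g gn.
      by rewrite ifN_eq ?uL //; apply/eqP; lia.
    by rewrite ifN_eq ?uR //; apply/eqP; lia.
  + move=> m /andP[hm mN2] /=.
    have -> : (m + m == h - 1)%N = false by lia.
    have -> : ((m + m).+1 == h - 1)%N = false by lia.
    case: eqP => [-> //|ne].
    by apply: t6; apply/andP; split; lia.
  + move=> m /andP[hm mN2] /=.
    have -> : (m + m == h - 1)%N = false by lia.
    have -> : ((m + m).+1 == h - 1)%N = false by lia.
    case: eqP => [-> //|ne].
    by apply: t7; apply/andP; split; lia.
- case: Iu => [h [u11 [/andP[h0 hN] fE] Fu t6 t7]].
  have [[u3 ut] [u0 uk] u00 uXW [uL uR]] := Fu.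
  split=> //; first by move: Ht => /=; lia.
  move: go; rewrite /= u11 => h1; have {}h1 : h = 1%N by lia.
  by rewrite h1 in t6 t7; split.
Qed.

End Preprocessing.

(** * Running time *)

(** With K = min(k, n), the parametric run makes O(K (2H + 3)) comparisons, each of which may cost a
    test, of time O(K (2H + 3)); hence the square. *)
Lemma optimize_time_le (R : realType) (P : network R) k H : wf_network P -> (0 < k)%N ->
  (optimize_time P k H <= 2500 * (minn k (nvert P) * (2 * H + 3)) ^ 2)%N.
Proof.
move=> [n0 _ _ _ _] k0; rewrite /optimize_time /test_time /greedy_time /search_time.
have : (0 < minn k (nvert P))%N by rewrite leq_min k0.
move: (minn k (nvert P)) => K K0; have : (0 < 2 * H + 3)%N by lia.
move: (2 * H + 3)%N => a a0; rewrite expnMn -!mulnn.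
have Ka : (0 < K * a)%N by rewrite muln_gt0 K0.
have test_le : (K * (2 * (a * (10 + 140)) + 50 + 70) + 30 <= 450 * (K * a))%N by nia.
nia.
Qed.

(** This is ln (1 + x) <= x at x = -1/2. *)
Lemma half_le_ln2 (R : realType) : 2^-1 <= ln 2 :> R.
Proof.
have := @le_ln1Dx R (- 2^-1); have -> : 1 + - 2^-1 = 2^-1 :> R by lra.
rewrite lnV ?posrE // => H; have : - ln 2 <= - 2^-1 :> R by apply: H; lra.
by rewrite lerN2.
Qed.

(** From 2^(H-1) <= n follows H - 1 <= 2 ln n, and 5 <= 10 ln 2 <= 10 ln n; so 2 (H - 1) + 5 is at
    most 14 ln n. *)
Lemma log_size_le_ln (R : realType) (P : network R) H :
  log_size P H -> (1 < nvert P)%N -> (2 * H + 3)%:R <= 20 * ln (nvert P)%:R :> R.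
Proof.
move=> [nN _ Hn] n1; have H0 : (0 < H)%N by case: H nN {Hn} => //; rewrite expn0; lia.
have {Hn} Hn : (2 ^ H.-1 <= nvert P)%N by case: Hn; lia.
have ln2 := half_le_ln2 R.
have le1 : ln 2 <= ln (nvert P)%:R :> R by rewrite ler_ln ?posrE ?ltr0n ?ler_nat //; lia.
have leH : ln 2 *+ H.-1 <= ln (nvert P)%:R :> R.
  rewrite -lnXn // ler_ln ?posrE ?exprn_gt0 ?ltr0n //; last by lia.
  by rewrite -natrX ler_nat.
have : H.-1%:R / 2 <= ln (nvert P)%:R :> R.
  by apply: le_trans leH; rewrite -[ln 2 *+ _]mulr_natl ler_wpM2l ?ler0n.
have -> : (2 * H + 3 = 2 * H.-1 + 5)%N by lia.
rewrite natrD natrM; lra.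
Qed.

(* One program, one constant C and one word-length exponent d (words have
   O(log (n + k)) bits) serve all the instances; the base of the logarithm
   only affects C. *)
Theorem theorem2 (R : realType) :
  exists (p : com) (C d : nat),
    forall (P : network R) (k : nat),
      wf_network P -> uniform_capacity P -> (1 <= k)%N ->
      exists (t : nat) (s : state R),
        [/\ exec ((nvert P + k) ^ d)%N p (input_state P k) t s,
            t%:R <= C%:R * ((nvert P)%:R + k%:R ^+ 2 * ln (nvert P)%:R ^+ 2) :> R
          & optimal_ksink P k (output_ksink s)].
Proof.
(* 400 is the square of the 20 in [log_size_le_ln]. As n + k >= 2, the exponent 6 leaves a factor (n
   + k)^5 >= 32 for intermediate words. *)
exists main, (2500 * 400)%N, 6%N => P k wfP unif k0.
have n0 : (0 < nvert P)%N by case: wfP.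
set B := ((nvert P + k) ^ 6)%N.
have HB : (32 * (nvert P + k) <= B)%N.
  rewrite /B expnS mulnC leq_mul2l; apply/orP; right.
  by rewrite -[32%N]/(2 ^ 5)%N leq_exp2r //; lia.
have runP : run B main (input_state P k) (fun t s => optimal_ksink P k (output_ksink s) /\
    exists H, log_size P H /\
      (t <= 185 * nvert P + 45 + 2500 * (minn k (nvert P) * (2 * H + 3)) ^ 2)%N).
  rewrite /main; apply: run_seq.
  apply: run_conseq (find_sizeP wfP HB) _ => t1 s1 [Ht1 [H [HH s3 [s0 sk] st [sI sR]]]].
  apply: run_seq; apply: run_conseq (fill_tablesP wfP HB HH s3 s0 sk st sI sR) _.
  move=> t2 s2 [Ht2 F2]; apply: run_seq.
  apply: run_conseq (build_treesP wfP HB HH F2) _ => t3 s3' [Ht3 T3 s3_00].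
  have [nN Nn _] := HH.
  apply: run_conseq (optimizeP wfP unif k0 nN Nn HB T3 s3_00) _ => t4 s4 [Ht4 opt].
  split=> //; exists H; split=> //; have := optimize_time_le H wfP k0; lia.
have [t [s [E [opt [H [HH Ht]]]]]] := runP; exists t, s; split=> //.
move: Ht; set K := minn k _; set a := (2 * H + 3)%N => Ht.
have {}Ht : (t <= 2500 * (nvert P + (K * a) ^ 2))%N by lia.
apply: le_trans (_ : (2500 * (nvert P + (K * a) ^ 2))%N%:R <= _); first by rewrite ler_nat.
rewrite !natrM -!mulrA ler_wpM2l ?ler0n // natrD natrX natrM.
case: (ltnP 1 (nvert P)) => [n1|n1].
  have Ha : a%:R <= 20 * ln (nvert P)%:R :> R by exact: log_size_le_ln.
  have HK : K%:R <= k%:R :> R by rewrite ler_nat geq_minl.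
  have le_Ka : K%:R * a%:R <= k%:R * (20 * ln (nvert P)%:R) :> R by rewrite ler_pM ?ler0n.
  have Ka0 : 0 <= K%:R * a%:R :> R by rewrite mulr_ge0 ?ler0n.
  have : (K%:R * a%:R) ^+ 2 <= (k%:R * (20 * ln (nvert P)%:R)) ^+ 2 :> R.
    by rewrite ler_pXn2r // nnegrE // (le_trans Ka0).
  have : 0 <= (nvert P)%:R :> R by rewrite ler0n.
  lra.
(* For n = 1 the logarithm vanishes and the term n pays for the constant time left, with H = 0. *)
have n_1 : nvert P = 1%N by lia.
have KE : K = 1%N by rewrite /K n_1; apply/minn_idPr.
have aE : a = 3%N.
  case: HH; rewrite n_1 /a => _; case: H {Ht a} => // H.
  by rewrite expnS; have := expn_gt0 2 H; lia.
rewrite n_1 KE aE ln1; lra.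
Qed.
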